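(* Let $\mathcal{C}$ be a modular category with braiding $\operatorname{br}$ and let $f\in\mathcal{C}$ be a distinguished boson or fermion. Let $\mathcal{C}=\mathcal{C}_+\oplus\mathcal{C}_-$ be the $\mathbb{Z}_2$-grading determined by $f$. There is a monoidal auto-equivalence $\mathcal{F}_f$ of $\mathcal{C}$ defined by $$\mathcal{F}_f|_{\mathcal{C}_+}:=\operatorname{Id}_{\mathcal{C}_+},\qquad\mathcal{F}_f|_{\mathcal{C}_-}:=f\otimes\operatorname{Id}_{\mathcal{C}_-},$$ with tensorator $\tau_{X,Y}:\mathcal{F}_f(X)\otimes\mathcal{F}_f(Y)\to\mathcal{F}_f(X\otimes Y)$ given by $$\tau_{X,Y}:=\begin{cases}\operatorname{id}_X\otimes\operatorname{id}_Y&X\in\mathcal{C}_+,\ Y\in\mathcal{C}_+,\\ \operatorname{id}_f\otimes\operatorname{id}_X\otimes\operatorname{id}_Y&X\in\mathcal{C}_-,\ Y\in\mathcal{C}_+,\\ \operatorname{br}_{X,f}\otimes\operatorname{id}_Y&X\in\mathcal{C}_+,\ Y\in\mathcal{C}_-,\\ (\operatorname{ev}_f\otimes\operatorname{id}_X\otimes\operatorname{id}_Y)(\operatorname{id}_f\otimes\operatorname{br}_{X,f}\otimes\operatorname{id}_Y)&X\in\mathcal{C}_-,\ Y\in\mathcal{C}_-.\end{cases}$$ Furthermore, this auto-equivalence is braided if and only if $f$ is a fermion.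
   Context: $\mathcal{C}$ is treated as strict, with braiding $\operatorname{br}_{X,Y}:X\otimes Y\to Y\otimes X$. A boson (resp. fermion) in $\mathcal{C}$ is a non-trivial invertible object $f$ with $f\otimes f\cong\mathbf{1}$ and self-braiding $\operatorname{br}_{f,f}=t_f\operatorname{id}_{f\otimes f}$ with $t_f=1$ (resp. $t_f=-1$); when $f$ has dimension $1$, $t_f$ is the twist of $f$. The object $f$ is self-dual, $\operatorname{ev}_f:f\otimes f\to\mathbf{1}$ denotes the evaluation isomorphism. The grading is $$\mathcal{C}_\pm:=\{X\in\mathcal{C}:\operatorname{br}_{X,f}=\pm\operatorname{br}_{f,X}^{-1}\},$$ which is faithful by modularity. *)

(* Defs.v *)
From mathcomp Require Import all_boot all_algebra.

Set Implicit Arguments.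
Unset Strict Implicit.
Unset Printing Implicit Defensive.

Import GRing.Theory.
Local Open Scope ring_scope.

Declare Scope cat_scope.
Delimit Scope cat_scope with cat.
Local Open Scope cat_scope.

Record linCat (k : fieldType) := LinCat {
  ob :> Type;
  mor : ob -> ob -> vectType k;
  idm : forall X, mor X X;
  mcomp : forall X Y Z, mor Y Z -> mor X Y -> mor X Z;
  comp1m : forall X Y (g : mor X Y), mcomp (idm Y) g = g;
  compm1 : forall X Y (g : mor X Y), mcomp g (idm X) = g;
  compA : forall W X Y Z (h : mor Y Z) (g : mor X Y) (u : mor W X),
    mcomp h (mcomp g u) = mcomp (mcomp h g) u;
  comp_linr : forall X Y Z (g : mor Y Z), linear (fun u : mor X Y => mcomp g u);
  comp_linl : forall X Y Z (u : mor X Y), linear (fun g : mor Y Z => mcomp g u)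
}.

Arguments idm {k l} X.
Arguments mcomp {k l X Y Z} g u : rename.

Notation "g ∘ u" := (mcomp g u) (at level 40, left associativity) : cat_scope.

Section LinCat.
Variables (k : fieldType) (C : linCat k).

Definition inverse_pair (X Y : C) (g : mor X Y) (h : mor Y X) : Prop :=
  h ∘ g = idm X /\ g ∘ h = idm Y.

Definition is_iso (X Y : C) (g : mor X Y) : Prop := exists h, inverse_pair g h.

Definition isomorphic (X Y : C) : Prop := exists g : mor X Y, is_iso g.

Definition is_mono (X Y : C) (g : mor X Y) : Prop :=
  forall (W : C) (u v : mor W X), g ∘ u = g ∘ v -> u = v.

Definition is_epi (X Y : C) (g : mor X Y) : Prop :=
  forall (Z : C) (u v : mor Y Z), u ∘ g = v ∘ g -> u = v.

Definition is_zero_ob (X : C) : Prop := idm X = 0.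

Definition is_kernel (X Y K : C) (g : mor X Y) (i : mor K X) : Prop :=
  g ∘ i = 0 /\
  forall (W : C) (u : mor W X), g ∘ u = 0 -> exists! v : mor W K, i ∘ v = u.

Definition is_cokernel (X Y Q : C) (g : mor X Y) (p : mor Y Q) : Prop :=
  p ∘ g = 0 /\
  forall (Z : C) (u : mor Y Z), u ∘ g = 0 -> exists! v : mor Q Z, v ∘ p = u.

Definition is_direct_sum (n : nat) (V : 'I_n -> C) (X : C)
    (i : forall j, mor (V j) X) (p : forall j, mor X (V j)) : Prop :=
  [/\ forall j, p j ∘ i j = idm (V j),
      forall j l, j != l -> p j ∘ i l = 0
    & \sum_(j < n) i j ∘ p j = idm X].

Definition direct_sum_of (n : nat) (V : 'I_n -> C) (X : C) : Prop :=
  exists i p, @is_direct_sum n V X i p.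

(* Direct sums of families indexed by ['I_0] are zero objects. *)
Definition abelian_cat : Prop :=
  [/\ forall (n : nat) (V : 'I_n -> C), exists X, direct_sum_of V X,
      forall (X Y : C) (g : mor X Y),
        (exists K (i : mor K X), is_kernel g i) /\
        (exists Q (p : mor Y Q), is_cokernel g p),
      forall (X Y : C) (g : mor X Y), is_mono g ->
        exists Z (h : mor Y Z), is_kernel h g
    & forall (X Y : C) (g : mor X Y), is_epi g ->
        exists W (h : mor W X), is_cokernel h g].

Definition simple_ob (X : C) : Prop :=
  ~ is_zero_ob X /\
  forall (Y : C) (i : mor Y X), is_mono i -> is_zero_ob Y \/ is_iso i.

Definition semisimple_cat : Prop :=
  abelian_cat /\
  forall X : C, exists (n : nat) (V : 'I_n -> C),
    (forall j, simple_ob (V j)) /\ direct_sum_of V X.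

Definition simple_representatives (n : nat) (V : 'I_n -> C) : Prop :=
  [/\ forall j, simple_ob (V j),
      forall j l, isomorphic (V j) (V l) -> j = l
    & forall X : C, simple_ob X -> exists j, isomorphic X (V j)].

End LinCat.

Record functor (k : fieldType) (C D : linCat k) := Functor {
  fob :> C -> D;
  fmor : forall X Y : C, mor X Y -> mor (fob X) (fob Y);
  fmor_id : forall X : C, fmor (idm X) = idm (fob X);
  fmor_comp : forall (X Y Z : C) (g : mor Y Z) (h : mor X Y),
    fmor (g ∘ h) = fmor g ∘ fmor h
}.

Arguments fmor {k C D} F {X Y} g : rename.

Definition linear_functor (k : fieldType) (C D : linCat k)
    (F : functor C D) : Prop :=
  forall X Y : C, linear (fun g : mor X Y => fmor F g).

Definition equivalence (k : fieldType) (C D : linCat k)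
    (F : functor C D) : Prop :=
  exists (G : functor D C)
         (eta : forall X : C, mor X (G (F X)))
         (eps : forall Y : D, mor (F (G Y)) Y),
    [/\ forall X, is_iso (eta X),
        forall X Y (g : mor X Y), fmor G (fmor F g) ∘ eta X = eta Y ∘ g,
        forall Y, is_iso (eps Y)
      & forall X Y (g : mor X Y), g ∘ eps X = eps Y ∘ fmor F (fmor G g)].

Record monCat (k : fieldType) := MonCat {
  mon_cat :> linCat k;
  unit_ob : mon_cat;
  tens : mon_cat -> mon_cat -> mon_cat;
  tensm : forall X X' Y Y' : mon_cat,
    mor X X' -> mor Y Y' -> mor (tens X Y) (tens X' Y');
  tensm_id : forall X Y, tensm (idm X) (idm Y) = idm (tens X Y);
  tensm_comp : forall X X' X'' Y Y' Y''
      (g' : mor X' X'') (g : mor X X') (h' : mor Y' Y'') (h : mor Y Y'),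
    tensm (g' ∘ g) (h' ∘ h) = tensm g' h' ∘ tensm g h;
  tensm_linr : forall X X' Y Y' (g : mor X X'),
    linear (fun h : mor Y Y' => tensm g h);
  tensm_linl : forall X X' Y Y' (h : mor Y Y'),
    linear (fun g : mor X X' => tensm g h);
  asc : forall X Y Z, mor (tens (tens X Y) Z) (tens X (tens Y Z));
  asci : forall X Y Z, mor (tens X (tens Y Z)) (tens (tens X Y) Z);
  ascK : forall X Y Z, inverse_pair (asc X Y Z) (asci X Y Z);
  lun : forall X, mor (tens unit_ob X) X;
  luni : forall X, mor X (tens unit_ob X);
  lunK : forall X, inverse_pair (lun X) (luni X);
  run : forall X, mor (tens X unit_ob) X;
  runi : forall X, mor X (tens X unit_ob);
  runK : forall X, inverse_pair (run X) (runi X);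
  asc_nat : forall X X' Y Y' Z Z'
      (g : mor X X') (h : mor Y Y') (u : mor Z Z'),
    asc X' Y' Z' ∘ tensm (tensm g h) u = tensm g (tensm h u) ∘ asc X Y Z;
  lun_nat : forall X X' (g : mor X X'),
    lun X' ∘ tensm (idm unit_ob) g = g ∘ lun X;
  run_nat : forall X X' (g : mor X X'),
    run X' ∘ tensm g (idm unit_ob) = g ∘ run X;
  pentagon : forall W X Y Z,
    tensm (idm W) (asc X Y Z) ∘ asc W (tens X Y) Z ∘ tensm (asc W X Y) (idm Z)
    = asc W X (tens Y Z) ∘ asc (tens W X) Y Z;
  triangle : forall X Y,
    tensm (idm X) (lun Y) ∘ asc X unit_ob Y = tensm (run X) (idm Y)
}.

Arguments unit_ob {k m}.
Arguments tens {k m} X Y.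
Arguments tensm {k m X X' Y Y'} g h.
Arguments asc {k m} X Y Z.
Arguments asci {k m} X Y Z.
Arguments lun {k m} X.
Arguments luni {k m} X.
Arguments run {k m} X.
Arguments runi {k m} X.

Notation "𝟙" := unit_ob : cat_scope.
Notation "X ⊗ Y" := (tens X Y) (at level 35, right associativity) : cat_scope.
Notation "g ⊠ h" := (tensm g h) (at level 35, right associativity) : cat_scope.

(* [X'] is a left dual of [X]. *)
Definition dual_pair (k : fieldType) (C : monCat k) (X X' : C)
    (ev : mor (X' ⊗ X) 𝟙) (coev : mor 𝟙 (X ⊗ X')) : Prop :=
  run X ∘ (idm X ⊠ ev) ∘ asc X X' X ∘ (coev ⊠ idm X) ∘ luni X = idm X /\
  lun X' ∘ (ev ⊠ idm X') ∘ asci X' X X' ∘ (idm X' ⊠ coev) ∘ runi X' = idm X'.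

Definition invertible_ob (k : fieldType) (C : monCat k) (X : C) : Prop :=
  exists Y : C, isomorphic (X ⊗ Y) 𝟙 /\ isomorphic (Y ⊗ X) 𝟙.

Record monFunctor (k : fieldType) (C D : monCat k) := MonFunctor {
  mon_fun :> functor C D;
  tau : forall X Y : C, mor (mon_fun X ⊗ mon_fun Y) (mon_fun (X ⊗ Y));
  unitor : mor 𝟙 (mon_fun 𝟙);
  tau_iso : forall X Y, is_iso (tau X Y);
  unitor_iso : is_iso unitor;
  tau_nat : forall (X X' Y Y' : C) (g : mor X X') (h : mor Y Y'),
    fmor mon_fun (g ⊠ h) ∘ tau X Y
    = tau X' Y' ∘ (fmor mon_fun g ⊠ fmor mon_fun h);
  tau_asc : forall X Y Z : C,
    fmor mon_fun (asc X Y Z) ∘ tau (X ⊗ Y) Z ∘ (tau X Y ⊠ idm (mon_fun Z))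
    = tau X (Y ⊗ Z) ∘ (idm (mon_fun X) ⊠ tau Y Z)
        ∘ asc (mon_fun X) (mon_fun Y) (mon_fun Z);
  tau_lun : forall X : C,
    fmor mon_fun (lun X) ∘ tau 𝟙 X ∘ (unitor ⊠ idm (mon_fun X))
    = lun (mon_fun X);
  tau_run : forall X : C,
    fmor mon_fun (run X) ∘ tau X 𝟙 ∘ (idm (mon_fun X) ⊠ unitor)
    = run (mon_fun X)
}.

Arguments tau {k C D} F X Y : rename.

Record braidedCat (k : fieldType) := BraidedCat {
  br_cat :> monCat k;
  br : forall X Y : br_cat, mor (X ⊗ Y) (Y ⊗ X);
  bri : forall X Y : br_cat, mor (Y ⊗ X) (X ⊗ Y);
  brK : forall X Y, inverse_pair (br X Y) (bri X Y);
  br_nat : forall (X X' Y Y' : br_cat) (g : mor X X') (h : mor Y Y'),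
    br X' Y' ∘ (g ⊠ h) = (h ⊠ g) ∘ br X Y;
  hexagon1 : forall X Y Z : br_cat,
    asc Y Z X ∘ br X (Y ⊗ Z) ∘ asc X Y Z
    = (idm Y ⊠ br X Z) ∘ asc Y X Z ∘ (br X Y ⊠ idm Z);
  hexagon2 : forall X Y Z : br_cat,
    asci Z X Y ∘ br (X ⊗ Y) Z ∘ asci X Y Z
    = (br X Z ⊠ idm Y) ∘ asci X Z Y ∘ (idm X ⊠ br Y Z)
}.

Arguments br {k b} X Y.
Arguments bri {k b} X Y.

Definition braided_functor (k : fieldType) (C D : braidedCat k)
    (F : monFunctor C D) : Prop :=
  forall X Y : C, fmor F (br X Y) ∘ tau F X Y = tau F Y X ∘ br (F X) (F Y).

Record ribbonCat (k : fieldType) := RibbonCat {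
  rib_cat :> braidedCat k;
  dual_ob : rib_cat -> rib_cat;
  ev : forall X : rib_cat, mor (dual_ob X ⊗ X) 𝟙;
  coev : forall X : rib_cat, mor 𝟙 (X ⊗ dual_ob X);
  dualP : forall X, dual_pair (ev X) (coev X);
  twist : forall X : rib_cat, mor X X;
  twist_iso : forall X, is_iso (twist X);
  twist_nat : forall (X Y : rib_cat) (g : mor X Y),
    twist Y ∘ g = g ∘ twist X;
  twist_tens : forall X Y : rib_cat,
    twist (X ⊗ Y) = br Y X ∘ br X Y ∘ (twist X ⊠ twist Y);
  twist_dual : forall X : rib_cat,
    (twist X ⊠ idm (dual_ob X)) ∘ coev X = (idm X ⊠ twist (dual_ob X)) ∘ coev X
}.

Arguments dual_ob {k r} X.
Arguments ev {k r} X.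
Arguments coev {k r} X.
Arguments twist {k r} X.

Definition qtrace (k : fieldType) (C : ribbonCat k) (X : C) (g : mor X X) :
    mor (𝟙 : C) 𝟙 :=
  ev X ∘ br X (dual_ob X) ∘ ((twist X ∘ g) ⊠ idm (dual_ob X)) ∘ coev X.

(* [S] is the S-matrix of the family [V], its entries being read in
   [k] = End(1). *)
Definition is_Smatrix (k : fieldType) (C : ribbonCat k) (n : nat)
    (V : 'I_n -> C) (S : 'M[k]_n) : Prop :=
  forall i j, S i j *: idm 𝟙 = qtrace (br (V j) (V i) ∘ br (V i) (V j)).

Record modularCat (k : fieldType) := ModularCat {
  mod_cat :> ribbonCat k;
  mod_semisimple : semisimple_cat mod_cat;
  mod_unit : \dim {: mor (𝟙 : mod_cat) 𝟙} = 1%N;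
  mod_S : exists (n : nat) (V : 'I_n -> mod_cat) (S : 'M[k]_n),
    [/\ simple_representatives V, is_Smatrix V S & S \in unitmx]
}.

Section Twisting.
Variables (k : fieldType) (C : braidedCat k) (f : C).

Definition involutive_ob : Prop :=
  [/\ ~ isomorphic f 𝟙, invertible_ob f & isomorphic (f ⊗ f) 𝟙].

Definition boson : Prop := involutive_ob /\ br f f = idm (f ⊗ f).

Definition fermion : Prop := involutive_ob /\ br f f = - idm (f ⊗ f).

(* The degree is a boolean: [false] for C_+ and [true] for C_-. *)
Definition in_degree (e : bool) (X : C) : Prop :=
  br X f = if e then - bri f X else bri f X.

Definition twob (e : bool) (X : C) : C := if e then f ⊗ X else X.

Definition twmor (e : bool) (X Y : C) (g : mor X Y) :
    mor (twob e X) (twob e Y) :=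
  if e return mor (twob e X) (twob e Y) then idm f ⊠ g else g.

(* br_{X,f} ⊗ id_Y *)
Definition slide (X Y : C) : mor (X ⊗ f ⊗ Y) (f ⊗ X ⊗ Y) :=
  asc f X Y ∘ (br X f ⊠ idm Y) ∘ asci X f Y.

Definition twtau (evf : mor (f ⊗ f) 𝟙) (e e' : bool) (X Y : C) :
    mor (twob e X ⊗ twob e' Y) (twob (e (+) e') (X ⊗ Y)) :=
  match e, e' return mor (twob e X ⊗ twob e' Y) (twob (e (+) e') (X ⊗ Y)) with
  | false, false => idm X ⊠ idm Y
  | true, false => asc f X Y
  | false, true => slide X Y
  | true, true =>
      lun (X ⊗ Y) ∘ (evf ⊠ idm (X ⊗ Y)) ∘ asci f f (X ⊗ Y)
        ∘ (idm f ⊠ slide X Y) ∘ asc f X (f ⊗ Y)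
  end.

(* [F] is the linear monoidal functor whose restriction to C_+ is Id, whose
   restriction to C_- is f ⊗ Id, and whose tensorator on homogeneous objects is
   [twtau].  The restrictions are identified by natural isomorphisms [th], not
   by equality: an arbitrary object is only isomorphic to a sum of objects of
   C_+ and C_-, and zero objects lie in both. *)
Definition is_twisting_functor (evf : mor (f ⊗ f) 𝟙) (F : monFunctor C C) :
    Prop :=
  linear_functor F /\
  exists th : forall (e : bool) (X : C), in_degree e X -> mor (twob e X) (F X),
    [/\ forall e X (hX : in_degree e X), is_iso (th e X hX),
        forall e X Y (hX : in_degree e X) (hY : in_degree e Y) (g : mor X Y),
          fmor F g ∘ th e X hX = th e Y hY ∘ twmor e g
      & forall e e' X Y (hX : in_degree e X) (hY : in_degree e' Y)
               (hXY : in_degree (e (+) e') (X ⊗ Y)),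
          tau F X Y ∘ (th e X hX ⊠ th e' Y hY)
          = th (e (+) e') (X ⊗ Y) hXY ∘ twtau evf e e' X Y].

End Twisting.

(* Main.v *)
Require Import Defs.
From Stdlib Require Import IndefiniteDescription.
From HB Require Import structures.
From mathcomp Require Import all_boot all_algebra.

Set Implicit Arguments.
Unset Strict Implicit.
Unset Printing Implicit Defensive.

Import GRing.Theory.
Local Open Scope ring_scope.
Local Open Scope cat_scope.

(** Tensoring with f is fully faithful, because f ⊗ f is the unit. Hence the
double braiding of f with X has the form id_f ⊠ m_X for a unique [monodromy]
m_X, and the braiding axioms make m a monoidal natural automorphism of the
identity functor with m^2 = 1. Its eigenspaces for 1 and -1 are the two degrees:
in characteristic other than 2 the idempotents (1 + m)/2 and (1 - m)/2 split
every X as X_+ ⊕ X_-, compatibly with tensor products.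

Let T_0 = Id and T_1 = f ⊗ -. The tensorator on T_a X ⊗ T_b Y moves X past the
second copy of f and then fuses T_a T_b into T_(a+b) by the evaluation. This
formula makes sense for every X and Y and every pair of labels (a, b). With
fixed labels it satisfies the associativity axiom for all objects
([twtau_assoc]); the only condition on f is that its two ways of cancelling in
f ⊗ f ⊗ f agree ([cap_self]), which holds because the self-braiding t of f
satisfies t^2 = 1. The functor is then X ↦ X_+ ⊕ f ⊗ X_-, and its axioms can be
checked on the components. It is an equivalence because T_a T_a ≅ Id
([twisting_equivalence]).

On homogeneous objects the tensorator commutes with the braiding, except that
in degree (1, 1) a sign -t appears: t from crossing the two copies of f, and
-1 from the double braiding of f with the second object ([twtau_br],
[homogeneous_braiding]). So a fermion gives a braided functor. If f is a boson
and the functor is braided, then 2 = 0 on X ⊗ X for X in C_-, which forces X = 0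
by rigidity, and f has trivial double braiding with every object. Then
multiplicativity of the trace ([trace_tens_transparent]) makes the row of f in
the S-matrix proportional to the row of the unit, so that invertibility of S
gives f ≅ 1 ([transparent_trivial]): a contradiction.

The categories are not strict. All diagrams are therefore written in
right-nested form: a morphism between tensor words is replaced by the family of
its extensions by an arbitrary last factor W, as in [cap], [cup] and [swap].
Composition of such families needs no associators, and the remaining ones
appear only where a composite object is split into its factors. *)

(** * Linear categories *)

Section LinearCategories.
Variables (k : fieldType) (C : linCat k).
Implicit Types W X Y Z : C.

Lemma compAr W X Y Z (h : mor Y Z) (g : mor X Y) (u : mor W X) :
  h ∘ g ∘ u = h ∘ (g ∘ u).
Proof. by rewrite Defs.compA. Qed.

Lemma compmA W X Y Z (h : mor Y Z) (g : mor X Y) (u : mor W X) :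
  h ∘ (g ∘ u) = h ∘ g ∘ u.
Proof. exact: Defs.compA. Qed.

(** Composites are kept nested to the right. [reassoc E] and its variants
rewrite with an equation E at the head of a longer composite, where the plain
rewriting rule would not match. *)
Lemma reassoc X Y Z (a : mor Y Z) (b : mor X Y) (c : mor X Z) :
  a ∘ b = c -> forall W (h : mor W X), a ∘ (b ∘ h) = c ∘ h.
Proof. by move=> <- W h; rewrite compmA. Qed.

Lemma reassoc3 X Y Y' Z (a : mor Y' Z) (a' : mor Y Y') (b : mor X Y)
    (c : mor X Z) :
  a ∘ (a' ∘ b) = c -> forall W (h : mor W X), a ∘ (a' ∘ (b ∘ h)) = c ∘ h.
Proof. by move=> <- W h; rewrite !compmA. Qed.

Lemma reassoc4 X Y Y' Y'' Z (a : mor Y'' Z) (a' : mor Y' Y'') (a'' : mor Y Y')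
    (b : mor X Y) (c : mor X Z) :
  a ∘ (a' ∘ (a'' ∘ b)) = c ->
  forall W (h : mor W X), a ∘ (a' ∘ (a'' ∘ (b ∘ h))) = c ∘ h.
Proof. by move=> <- W h; rewrite !compmA. Qed.

Lemma compDr X Y Z (g : mor Y Z) (u v : mor X Y) :
  g ∘ (u + v) = g ∘ u + g ∘ v.
Proof. by have := comp_linr g 1 u v; rewrite !scale1r. Qed.

Lemma compDl X Y Z (u v : mor Y Z) (g : mor X Y) :
  (u + v) ∘ g = u ∘ g + v ∘ g.
Proof. by have := comp_linl g 1 u v; rewrite !scale1r. Qed.

Lemma comp0r X Y Z (g : mor Y Z) : g ∘ (0 : mor X Y) = 0.
Proof. by apply: (addrI (g ∘ 0)); rewrite -compDr !addr0. Qed.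

Lemma comp0l X Y Z (g : mor X Y) : (0 : mor Y Z) ∘ g = 0.
Proof. by apply: (addrI (0 ∘ g)); rewrite -compDl !addr0. Qed.

Lemma compZr X Y Z (g : mor Y Z) c (u : mor X Y) : g ∘ (c *: u) = c *: (g ∘ u).
Proof. by have := comp_linr g c u 0; rewrite comp0r !addr0. Qed.

Lemma compZl X Y Z (g : mor X Y) c (u : mor Y Z) : (c *: u) ∘ g = c *: (u ∘ g).
Proof. by have := comp_linl g c u 0; rewrite comp0l !addr0. Qed.

Lemma compNl X Y Z (g : mor X Y) (u : mor Y Z) : (- u) ∘ g = - (u ∘ g).
Proof. by rewrite -scaleN1r compZl scaleN1r. Qed.

Lemma inverse_pair_sym X Y (g : mor X Y) (h : mor Y X) :
  inverse_pair g h -> inverse_pair h g.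
Proof. by case. Qed.

Lemma inverse_pair_id X : inverse_pair (idm X) (idm X).
Proof. by split; rewrite comp1m. Qed.

Lemma inverse_pair_comp X Y Z (g : mor X Y) g' (h : mor Y Z) h' :
  inverse_pair g g' -> inverse_pair h h' -> inverse_pair (h ∘ g) (g' ∘ h').
Proof.
move=> [g'g gg'] [h'h hh']; split.
- by rewrite compAr (reassoc h'h) comp1m.
- by rewrite compAr (reassoc gg') comp1m.
Qed.

Lemma is_iso_id X : is_iso (idm X).
Proof. by exists (idm X); apply: inverse_pair_id. Qed.

Lemma is_iso_comp X Y Z (g : mor X Y) (h : mor Y Z) :
  is_iso g -> is_iso h -> is_iso (h ∘ g).
Proof.
by move=> [g' ig] [h' ih]; exists (g' ∘ h'); apply: inverse_pair_comp.
Qed.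

Lemma iso_mono X Y (g : mor X Y) : is_iso g -> is_mono g.
Proof.
by move=> [h [hg _]] W u v /(congr1 (mcomp h)); rewrite !compmA hg !comp1m.
Qed.

Lemma iso_epi X Y (g : mor X Y) : is_iso g -> is_epi g.
Proof.
move=> [h [_ gh]] Z u v /(congr1 (fun w => w ∘ h)).
by rewrite !compAr gh !compm1.
Qed.

Lemma inv_mono X Y (g : mor X Y) h : inverse_pair g h -> is_mono g.
Proof. by move=> gh; apply: iso_mono; exists h. Qed.

Lemma inv_epi X Y (g : mor X Y) h : inverse_pair g h -> is_epi g.
Proof. by move=> gh; apply: iso_epi; exists h. Qed.

End LinearCategories.

(** * Monoidal categories and their unit coherence *)

Section MonoidalCategories.
Variables (k : fieldType) (C : monCat k).
Implicit Types A B V W X Y Z : C.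

Lemma tensmDr X X' Y Y' (g : mor X X') (u v : mor Y Y') :
  g ⊠ (u + v) = g ⊠ u + g ⊠ v.
Proof. by have := tensm_linr (Y := Y) (Y' := Y') g 1 u v; rewrite !scale1r. Qed.

Lemma tensmDl X X' Y Y' (u v : mor X X') (g : mor Y Y') :
  (u + v) ⊠ g = u ⊠ g + v ⊠ g.
Proof. by have := tensm_linl (X := X) (X' := X') g 1 u v; rewrite !scale1r. Qed.

Lemma tensm0r X X' Y Y' (g : mor X X') : g ⊠ (0 : mor Y Y') = 0.
Proof. by apply: (addrI (g ⊠ 0)); rewrite -tensmDr !addr0. Qed.

Lemma tensm0l X X' Y Y' (g : mor Y Y') : (0 : mor X X') ⊠ g = 0.
Proof. by apply: (addrI (0 ⊠ g)); rewrite -tensmDl !addr0. Qed.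

Lemma tensmZr X X' Y Y' (g : mor X X') c (u : mor Y Y') :
  g ⊠ (c *: u) = c *: (g ⊠ u).
Proof.
by have := tensm_linr (Y := Y) (Y' := Y') g c u 0; rewrite tensm0r !addr0.
Qed.

Lemma tensmZl X X' Y Y' (g : mor Y Y') c (u : mor X X') :
  (c *: u) ⊠ g = c *: (u ⊠ g).
Proof.
by have := tensm_linl (X := X) (X' := X') g c u 0; rewrite tensm0l !addr0.
Qed.

Lemma tensmMr A X Y Z (g : mor Y Z) (h : mor X Y) :
  idm A ⊠ (g ∘ h) = (idm A ⊠ g) ∘ (idm A ⊠ h).
Proof. by rewrite -tensm_comp comp1m. Qed.

Lemma tensmMl A X Y Z (g : mor Y Z) (h : mor X Y) :
  (g ∘ h) ⊠ idm A = (g ⊠ idm A) ∘ (h ⊠ idm A).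
Proof. by rewrite -tensm_comp comp1m. Qed.

Lemma tensm_lr X X' Y Y' (g : mor X X') (h : mor Y Y') :
  g ⊠ h = (g ⊠ idm Y') ∘ (idm X ⊠ h).
Proof. by rewrite -tensm_comp comp1m compm1. Qed.

Lemma tensm_rl X X' Y Y' (g : mor X X') (h : mor Y Y') :
  g ⊠ h = (idm X' ⊠ h) ∘ (g ⊠ idm Y).
Proof. by rewrite -tensm_comp comp1m compm1. Qed.

Lemma tensm_exchange X X' Y Y' (g : mor X X') (h : mor Y Y') :
  (g ⊠ idm Y') ∘ (idm X ⊠ h) = (idm X' ⊠ h) ∘ (g ⊠ idm Y).
Proof. by rewrite -tensm_lr -tensm_rl. Qed.

Lemma inverse_pair_tens X X' Y Y' (g : mor X X') g' (h : mor Y Y') h' :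
  inverse_pair g g' -> inverse_pair h h' -> inverse_pair (g ⊠ h) (g' ⊠ h').
Proof.
by move=> [g'g gg'] [h'h hh']; split; rewrite -tensm_comp ?g'g ?h'h ?gg' ?hh';
  rewrite tensm_id.
Qed.

Lemma is_iso_tens X X' Y Y' (g : mor X X') (h : mor Y Y') :
  is_iso g -> is_iso h -> is_iso (g ⊠ h).
Proof.
by move=> [g' ig] [h' ih]; exists (g' ⊠ h'); apply: inverse_pair_tens.
Qed.

Lemma ascKl X Y Z : asci X Y Z ∘ asc X Y Z = idm _.
Proof. by case: (ascK X Y Z). Qed.
Lemma ascKr X Y Z : asc X Y Z ∘ asci X Y Z = idm _.
Proof. by case: (ascK X Y Z). Qed.
Lemma lunKr X : lun X ∘ luni X = idm _. Proof. by case: (lunK X). Qed.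
Lemma runKr X : run X ∘ runi X = idm _. Proof. by case: (runK X). Qed.

Lemma asc_mono X Y Z : is_mono (asc X Y Z).
Proof. exact: inv_mono (ascK X Y Z). Qed.
Lemma asc_epi X Y Z : is_epi (asc X Y Z).
Proof. exact: inv_epi (ascK X Y Z). Qed.
Lemma asci_mono X Y Z : is_mono (asci X Y Z).
Proof. exact: inv_mono (inverse_pair_sym (ascK X Y Z)). Qed.
Lemma asci_epi X Y Z : is_epi (asci X Y Z).
Proof. exact: inv_epi (inverse_pair_sym (ascK X Y Z)). Qed.
Lemma lun_mono X : is_mono (lun X).
Proof. exact: inv_mono (lunK X). Qed.
Lemma lun_epi X : is_epi (lun X).
Proof. exact: inv_epi (lunK X). Qed.
Lemma run_mono X : is_mono (run X).
Proof. exact: inv_mono (runK X). Qed.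
Lemma run_epi X : is_epi (run X).
Proof. exact: inv_epi (runK X). Qed.

Lemma asci_nat X X' Y Y' Z Z' (g : mor X X') (h : mor Y Y') (u : mor Z Z') :
  asci X' Y' Z' ∘ (g ⊠ (h ⊠ u)) = ((g ⊠ h) ⊠ u) ∘ asci X Y Z.
Proof.
by apply: asc_mono; rewrite (reassoc (ascKr _ _ _)) (reassoc (asc_nat _ _ _))
  compAr ascKr comp1m compm1.
Qed.

Lemma luni_nat X X' (g : mor X X') : (idm 𝟙 ⊠ g) ∘ luni X = luni X' ∘ g.
Proof.
by apply: lun_mono; rewrite (reassoc (lun_nat _)) compAr lunKr
  (reassoc (lunKr _)) comp1m compm1.
Qed.

Lemma runi_nat X X' (g : mor X X') : (g ⊠ idm 𝟙) ∘ runi X = runi X' ∘ g.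
Proof.
by apply: run_mono; rewrite (reassoc (run_nat _)) compAr runKr
  (reassoc (runKr _)) comp1m compm1.
Qed.

Lemma unit_tensm_inj X Y (g h : mor X Y) : idm 𝟙 ⊠ g = idm 𝟙 ⊠ h -> g = h.
Proof. by move=> gh; apply: lun_epi; rewrite -!lun_nat gh. Qed.

Lemma tensm_unit_inj X Y (g h : mor X Y) : g ⊠ idm 𝟙 = h ⊠ idm 𝟙 -> g = h.
Proof. by move=> gh; apply: run_epi; rewrite -!run_nat gh. Qed.

Lemma pentagonr W X Y Z :
  (idm W ⊠ asc X Y Z) ∘ (asc W (X ⊗ Y) Z ∘ (asc W X Y ⊠ idm Z))
  = asc W X (Y ⊗ Z) ∘ asc (W ⊗ X) Y Z.
Proof. by rewrite compmA pentagon. Qed.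

(** Kelly's coherence theorem: this and the next two lemmas follow from the
pentagon and the triangle, since tensoring with the unit is faithful. *)
Lemma lun_tens X Y : lun (X ⊗ Y) ∘ asc 𝟙 X Y = lun X ⊠ idm Y.
Proof.
apply: unit_tensm_inj; apply: (@asc_epi 𝟙 (𝟙 ⊗ X) Y).
have epi : is_epi (asc 𝟙 𝟙 X ⊠ idm Y).
  exact: inv_epi (inverse_pair_tens (ascK _ _ _) (inverse_pair_id _)).
apply: epi; rewrite tensmMr !compAr pentagonr (reassoc (triangle _ _)).
rewrite (reassoc (esym (asc_nat _ _ _))) compAr -tensmMl triangle.
by rewrite -(tensm_id X Y) asc_nat.
Qed.

Lemma run_tens X Y : (idm X ⊠ run Y) ∘ asc X Y 𝟙 = run (X ⊗ Y).
Proof.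
apply: tensm_unit_inj; apply: (@asc_mono X Y 𝟙).
rewrite -triangle tensmMl !compmA asc_nat -triangle tensmMr.
rewrite -[RHS]compmA.
rewrite -(tensm_id X Y) compmA asc_nat !compAr.
by rewrite pentagonr.
Qed.

Lemma lun_unit : lun 𝟙 = run (𝟙 : C).
Proof.
apply: tensm_unit_inj; rewrite -lun_tens -triangle.
by congr (_ ∘ _); apply: lun_mono; rewrite lun_nat.
Qed.

Lemma luni_unit : luni 𝟙 = runi (𝟙 : C).
Proof. by apply: lun_mono; rewrite lunKr lun_unit runKr. Qed.

Lemma runi_tens X Y : (idm X ⊠ runi Y) = asc X Y 𝟙 ∘ runi (X ⊗ Y).
Proof.
have mono : is_mono (idm X ⊠ run Y).
  exact: inv_mono (inverse_pair_tens (inverse_pair_id _) (runK _)).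
by apply: mono; rewrite compmA run_tens runKr -tensmMr runKr tensm_id.
Qed.

End MonoidalCategories.

(** * Caps and cups *)

(** A pairing c, extended by a last factor W: the right-nested form of c. The
definition is locked so that rewriting with associativity of composition does
not look inside it. *)
HB.lock Definition cap (k : fieldType) (C : monCat k) (A B : C)
    (c : mor (A ⊗ B) 𝟙) (W : C) : mor (A ⊗ B ⊗ W) W :=
  lun W ∘ ((c ⊠ idm W) ∘ asci A B W).

HB.lock Definition cup (k : fieldType) (C : monCat k) (A B : C)
    (d : mor 𝟙 (A ⊗ B)) (W : C) : mor W (A ⊗ B ⊗ W) :=
  asc A B W ∘ ((d ⊠ idm W) ∘ luni W).

(** The snake identity that straightens X, in terms of [cup]. Mates are built
from it. *)
Definition zigzag (k : fieldType) (C : monCat k) (X X' : C)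
    (e : mor (X' ⊗ X) 𝟙) (d : mor 𝟙 (X ⊗ X')) : Prop :=
  (idm X ⊠ e) ∘ cup d X = runi X.

Section CapsAndCups.
Variables (k : fieldType) (C : monCat k).
Implicit Types A B V W X Y Z : C.

Lemma cupE A B (d : mor 𝟙 (A ⊗ B)) W :
  cup d W = asc A B W ∘ ((d ⊠ idm W) ∘ luni W).
Proof. by rewrite cup.unlock. Qed.

Lemma cap_nat A B (c : mor (A ⊗ B) 𝟙) W W' (g : mor W W') :
  cap c W' ∘ (idm A ⊠ (idm B ⊠ g)) = g ∘ cap c W.
Proof.
rewrite cap.unlock !compAr asci_nat tensm_id.
by rewrite (reassoc (tensm_exchange _ _)) !compmA lun_nat.
Qed.

Lemma cup_nat A B (d : mor 𝟙 (A ⊗ B)) W W' (g : mor W W') :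
  (idm A ⊠ (idm B ⊠ g)) ∘ cup d W = cup d W' ∘ g.
Proof.
rewrite cup.unlock !compAr -luni_nat (reassoc (esym (asc_nat _ _ _))) compAr
  tensm_id.
by rewrite (reassoc (tensm_exchange _ _)) compAr.
Qed.

(** The family [cap c] is compatible with tensoring on the right, so it is
determined by c; likewise for [cup_tens]. *)
Lemma cap_tens A B (c : mor (A ⊗ B) 𝟙) V W :
  cap c (V ⊗ W) ∘ (idm A ⊠ asc B V W) ∘ asc A (B ⊗ V) W = cap c V ⊠ idm W.
Proof.
have epi : is_epi (asc A B V ⊠ idm W).
  exact: inv_epi (inverse_pair_tens (ascK _ _ _) (inverse_pair_id _)).
apply: epi; rewrite !compAr pentagonr -tensmMl cap.unlock !compAr ascKl compm1.
rewrite (reassoc (ascKl _ _ _)) comp1m -tensm_id -asc_nat compmA lun_tens.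
by rewrite -tensmMl.
Qed.

Lemma luni_tens X Y : asc 𝟙 X Y ∘ (luni X ⊠ idm Y) = luni (X ⊗ Y).
Proof.
apply: lun_mono.
by rewrite compmA lun_tens -tensmMl !lunKr tensm_id.
Qed.

Lemma cup_tens A B (d : mor 𝟙 (A ⊗ B)) V W :
  (idm A ⊠ asc B V W) ∘ (asc A (B ⊗ V) W ∘ (cup d V ⊠ idm W)) = cup d (V ⊗ W).
Proof.
rewrite cup.unlock !tensmMl ?compAr (reassoc3 (pentagonr _ _ _ _)) !compAr.
by rewrite (reassoc (asc_nat _ _ _)) compAr luni_tens tensm_id.
Qed.

Lemma cap_unit A B (c : mor (A ⊗ B) 𝟙) : cap c 𝟙 = c ∘ (idm A ⊠ run B).
Proof.
apply: asc_epi; rewrite cap.unlock !compAr ascKl compm1 lun_unit run_nat.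
by rewrite run_tens.
Qed.

Lemma cup_unit A B (d : mor 𝟙 (A ⊗ B)) : cup d 𝟙 = (idm A ⊠ runi B) ∘ d.
Proof. by rewrite cup.unlock ?compAr luni_unit runi_nat runi_tens compAr. Qed.

Lemma dual_zigzag X X' (e : mor (X' ⊗ X) 𝟙) (d : mor 𝟙 (X ⊗ X')) :
  dual_pair e d -> zigzag e d.
Proof.
move=> [zz _]; apply: run_mono; rewrite runKr -[RHS]zz.
by rewrite cup.unlock !compAr.
Qed.

Lemma zigzag_cap X X' (e : mor (X' ⊗ X) 𝟙) (d : mor 𝟙 (X ⊗ X')) W :
  zigzag e d -> (idm X ⊠ cap e W) ∘ cup d (X ⊗ W) = idm (X ⊗ W).
Proof.
move=> zz; rewrite cap.unlock !tensmMr !compAr -cup_tens.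
rewrite (reassoc (esym (tensmMr X (asci _ _ _) _))) ascKl tensm_id comp1m.
rewrite (reassoc (esym (asc_nat _ _ _))) compAr -tensmMl zz.
by rewrite (reassoc (triangle _ _)) -tensmMl runKr tensm_id.
Qed.

End CapsAndCups.

(** * The braiding past a factor of a tensor word *)

(** The braiding of X past A inside a word ending in W. It is [slide], locked
for the same reason as [cap]. *)
HB.lock Definition swap (k : fieldType) (C : braidedCat k) (A X W : C) :
    mor (X ⊗ A ⊗ W) (A ⊗ X ⊗ W) := slide A X W.

Section BraidedCategories.
Variables (k : fieldType) (C : braidedCat k).
Implicit Types A B V W X Y Z : C.

Lemma brKl X Y : bri X Y ∘ br X Y = idm _. Proof. by case: (brK X Y). Qed.
Lemma brKr X Y : br X Y ∘ bri X Y = idm _. Proof. by case: (brK X Y). Qed.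

Lemma hexagon1r X Y Z :
  asc Y Z X ∘ (br X (Y ⊗ Z) ∘ asc X Y Z)
  = (idm Y ⊠ br X Z) ∘ (asc Y X Z ∘ (br X Y ⊠ idm Z)).
Proof. by rewrite !compmA hexagon1. Qed.

Lemma hexagon2r X Y Z :
  asci Z X Y ∘ (br (X ⊗ Y) Z ∘ asci X Y Z)
  = (br X Z ⊠ idm Y) ∘ (asci X Z Y ∘ (idm X ⊠ br Y Z)).
Proof. by rewrite !compmA hexagon2. Qed.

Lemma swapE A X W :
  swap A X W = asc A X W ∘ ((br X A ⊠ idm W) ∘ asci X A W).
Proof. by rewrite swap.unlock /slide compAr. Qed.

Lemma swap_iso A X W : is_iso (swap A X W).
Proof.
rewrite swap.unlock /slide; apply: is_iso_comp.
  by exists (asc X A W); apply: inverse_pair_sym (ascK _ _ _).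
apply: is_iso_comp; last by exists (asci A X W); apply: ascK.
exists (bri X A ⊠ idm W).
exact: inverse_pair_tens (brK _ _) (inverse_pair_id _).
Qed.

Lemma swap_asc A X W :
  swap A X W ∘ asc X A W = asc A X W ∘ (br X A ⊠ idm W).
Proof. by rewrite swapE !compAr ascKl compm1. Qed.

Lemma swap_nat A A' X X' W W' (a : mor A A') (g : mor X X') (h : mor W W') :
  (a ⊠ (g ⊠ h)) ∘ swap A X W = swap A' X' W' ∘ (g ⊠ (a ⊠ h)).
Proof.
rewrite !swapE !compAr asci_nat (reassoc (esym (asc_nat _ _ _))) !compAr.
congr (_ ∘ _); rewrite !compmA -!tensm_comp br_nat.
by rewrite comp1m compm1.
Qed.

Lemma br_tensr X A B :
  br X (A ⊗ B) = asci A B X ∘ ((idm A ⊠ br X B) ∘ swap A X B).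
Proof.
apply: asc_epi; apply: asc_mono; rewrite !compAr swap_asc.
by rewrite (reassoc (ascKr _ _ _)) comp1m compmA hexagon1 compAr.
Qed.

Lemma br_tensl A B Z :
  br (A ⊗ B) Z = swap Z A B ∘ ((idm A ⊠ br B Z) ∘ asc A B Z).
Proof.
apply: asci_epi; apply: asci_mono; rewrite !compAr ascKr compm1 swapE.
by rewrite !compAr (reassoc (ascKl _ _ _)) comp1m compmA hexagon2 compAr.
Qed.

(** The two hexagons in right-nested form: swapping with A ⊗ B is swapping with
A and then with B, and similarly in the other variable in [swap_tensl]. *)
Lemma swap_tensr A B X W :
  asc A B (X ⊗ W) ∘ swap (A ⊗ B) X W
  = (idm A ⊠ swap B X W) ∘ (swap A X (B ⊗ W) ∘ (idm X ⊠ asc A B W)).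
Proof.
apply: asc_epi.
have epi : is_epi (asc X A B ⊠ idm W).
  exact: inv_epi (inverse_pair_tens (ascK _ _ _) (inverse_pair_id _)).
apply: epi; rewrite !compAr pentagonr (reassoc (swap_asc _ _ _)).
rewrite (reassoc (swap_asc _ _ _)) !compAr -(tensm_id B W) -asc_nat.
rewrite !(reassoc (esym (pentagonr _ _ _ _))) !compAr.
rewrite (reassoc (esym (tensmMr _ _ _))) swap_asc tensmMr !compAr.
rewrite (reassoc (esym (asc_nat _ _ _))) !compAr -!tensmMl.
by rewrite hexagon1r.
Qed.

Lemma swap_tensl A X Y Z :
  (idm A ⊠ asc X Y Z) ∘ swap A (X ⊗ Y) Z
  = swap A X (Y ⊗ Z) ∘ ((idm X ⊠ swap A Y Z) ∘ asc X Y (A ⊗ Z)).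
Proof.
apply: asc_epi.
have epi : is_epi (asci X Y A ⊠ idm Z).
  exact: inv_epi (inverse_pair_tens (inverse_pair_sym (ascK _ _ _))
                                    (inverse_pair_id _)).
have pent : asc X Y (A ⊗ Z) ∘ (asc (X ⊗ Y) A Z ∘ (asci X Y A ⊠ idm Z))
    = (idm X ⊠ asc Y A Z) ∘ asc X (Y ⊗ A) Z.
  by rewrite (reassoc (esym (pentagonr _ _ _ _))) !compAr -tensmMl ascKr
    tensm_id compm1.
apply: epi; rewrite !compAr pent (reassoc (swap_asc _ _ _)).
rewrite (reassoc (esym (tensmMr X (swap _ _ _) _))) swap_asc tensmMr !compAr.
rewrite (esym (asc_nat _ _ _)).
rewrite -tensmMl.
have -> : br (X ⊗ Y) A ∘ asci X Y A
    = asc A X Y ∘ ((br X A ⊠ idm Y) ∘ (asci X A Y ∘ (idm X ⊠ br Y A))).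
  by rewrite -hexagon2r (reassoc (ascKr _ _ _)) comp1m.
rewrite tensmMl (reassoc3 (pentagonr _ _ _ _)) !compAr tensmMl.
rewrite (reassoc (asc_nat _ _ _)) tensm_id swapE !compAr; congr (_ ∘ (_ ∘ _)).
apply: asc_mono; rewrite (reassoc (ascKr _ _ _)) comp1m tensmMl.
rewrite (reassoc (esym (pentagonr _ _ _ _))) !compAr; congr (_ ∘ (_ ∘ _)).
by rewrite -!tensmMl (reassoc (ascKr _ _ _)) comp1m.
Qed.

(** The family [swap A X] is compatible with tensoring on the right: only the
pentagon is involved. *)
Lemma swap_asc_tens A X V W :
  (idm A ⊠ asc X V W) ∘ (asc A (X ⊗ V) W ∘ (swap A X V ⊠ idm W))
  = swap A X (V ⊗ W) ∘ ((idm X ⊠ asc A V W) ∘ asc X (A ⊗ V) W).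
Proof.
have epi : is_epi (asc X A V ⊠ idm W).
  exact: inv_epi (inverse_pair_tens (ascK _ _ _) (inverse_pair_id _)).
apply: epi; rewrite !compAr pentagonr (reassoc (swap_asc _ _ _)) -tensmMl.
rewrite swap_asc tensmMl (reassoc3 (pentagonr _ _ _ _)) !compAr asc_nat.
by rewrite tensm_id.
Qed.

(** The braiding with the unit is trivial. The hexagon for 𝟙 ⊗ 𝟙 shows that
the composite is idempotent up to unitors, and it is invertible. *)
Lemma lun_swap X W : lun (X ⊗ W) ∘ swap 𝟙 X W = idm X ⊠ lun W.
Proof.
have lun2 V : idm 𝟙 ⊠ lun V = lun (𝟙 ⊗ V) by apply: lun_mono; rewrite lun_nat.
have step V : lun (X ⊗ 𝟙 ⊗ V) ∘ swap 𝟙 X (𝟙 ⊗ V) = idm X ⊠ lun (𝟙 ⊗ V).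
  have epi : is_epi (idm X ⊠ asc 𝟙 𝟙 V).
    exact: inv_epi (inverse_pair_tens (inverse_pair_id _) (ascK _ _ _)).
  have mono : is_mono (lun (X ⊗ V) ∘ swap 𝟙 X V).
    by apply/iso_mono/is_iso_comp; [exact: swap_iso | exists (luni _); exact:
      lunK].
  apply: mono; apply: epi; rewrite -lun2 !compAr -tensmMr triangle.
  rewrite -swap_nat tensm_id -triangle !compAr swap_tensr.
  by rewrite !(reassoc (lun_nat _)) !compAr (reassoc (lun_nat _)) !compAr.
have epi : is_epi (idm X ⊠ lun (𝟙 ⊗ W)).
  exact: inv_epi (inverse_pair_tens (inverse_pair_id _) (lunK _)).
apply: epi; rewrite -{1}lun2 !compAr -swap_nat.
by rewrite (reassoc (lun_nat _)) compAr step.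
Qed.

Lemma swap_lun A Z : (idm A ⊠ lun Z) ∘ swap A 𝟙 Z = lun (A ⊗ Z).
Proof.
apply: unit_tensm_inj.
apply: (@asc_epi _ _ 𝟙 𝟙 (A ⊗ Z)).
have mono : is_mono ((idm A ⊠ lun Z) ∘ swap A 𝟙 Z).
  apply/iso_mono/is_iso_comp; first exact: swap_iso.
  by exists (idm A ⊠ luni Z); apply: inverse_pair_tens (inverse_pair_id _)
    (lunK _).
apply: mono.
rewrite tensmMr !compAr triangle -(tensm_id A Z) -swap_nat -triangle tensmMr.
by rewrite !compAr swap_tensl (reassoc (swap_nat _ _ _)) !compAr.
Qed.

Lemma lun_br X : lun X ∘ br X 𝟙 = run X.
Proof.
apply: tensm_unit_inj; rewrite -triangle -lun_swap !compAr swap_asc.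
by rewrite (reassoc (lun_tens _ _)) -tensmMl.
Qed.

Lemma run_br X : run X ∘ br 𝟙 X = lun X.
Proof.
apply: tensm_unit_inj; rewrite -lun_tens -swap_lun !compAr swap_asc.
by rewrite (reassoc (triangle _ _)) -tensmMl.
Qed.

(** Naturality of the braiding with respect to c, whose target is the unit:
a cap may be pulled across X. In [cap_swapr] the object X starts on the left of
the pair, in [cap_swapl] on its right. *)
Lemma cap_swapr A B (c : mor (A ⊗ B) 𝟙) X W :
  cap c (X ⊗ W) ∘ ((idm A ⊠ swap B X W) ∘ swap A X (B ⊗ W)) = idm X ⊠ cap c W.
Proof.
have epi : is_epi (idm X ⊠ asc A B W).
  exact: inv_epi (inverse_pair_tens (inverse_pair_id _) (ascK _ _ _)).
apply: epi; rewrite !compAr -swap_tensr cap.unlock !compAr.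
rewrite (reassoc (ascKl _ _ _)) comp1m -tensmMr !compAr ascKl compm1.
by rewrite tensmMr -lun_swap !compAr -swap_nat tensm_id.
Qed.

Lemma cap_swapl A B (c : mor (A ⊗ B) 𝟙) X W :
  (idm X ⊠ cap c W) ∘ (swap X A (B ⊗ W) ∘ (idm A ⊠ swap X B W)) = cap c (X ⊗ W).
Proof.
apply: asc_epi; rewrite !compAr -swap_tensl cap.unlock !compAr ascKl compm1.
rewrite (reassoc (esym (tensmMr X (_ ∘ _) _))) !compAr ascKl compm1.
by rewrite tensmMr !compAr swap_nat (reassoc (swap_lun _ _)) tensm_id.
Qed.

End BraidedCategories.

(** * The tensorator and its associativity *)

Lemma cap_cupK (k : fieldType) (C : monCat k) (A B : C)
    (c : mor (A ⊗ B) 𝟙) d W :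
  inverse_pair c d -> inverse_pair (cap c W) (cup d W).
Proof.
move=> cd; rewrite cap.unlock cup.unlock (compmA (asc _ _ _)).
apply: inverse_pair_comp (lunK W).
apply: (inverse_pair_comp (inverse_pair_sym (ascK A B W))).
exact: inverse_pair_tens cd (inverse_pair_id W).
Qed.

Section Whiskering.
Variables (k : fieldType) (C : braidedCat k) (f : C).
Implicit Types V W X Y Z : C.

Lemma twmor_id e X : twmor f e (idm X) = idm (twob f e X).
Proof. by case: e => //=; rewrite tensm_id. Qed.

Lemma twmorM e X Y Z (g : mor Y Z) (h : mor X Y) :
  twmor f e (g ∘ h) = twmor f e g ∘ twmor f e h.
Proof. by case: e => //=; rewrite tensmMr. Qed.

Lemma twmorD e X Y (g h : mor X Y) :
  twmor f e (g + h) = twmor f e g + twmor f e h.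
Proof. by case: e => //=; rewrite tensmDr. Qed.

Lemma twmorZ e X Y c (g : mor X Y) : twmor f e (c *: g) = c *: twmor f e g.
Proof. by case: e => //=; rewrite tensmZr. Qed.

Lemma twmor0 e X Y : twmor f e (0 : mor X Y) = 0.
Proof. by case: e => //=; rewrite tensm0r. Qed.

Lemma twmor_inverse e X Y (g : mor X Y) h :
  inverse_pair g h -> inverse_pair (twmor f e g) (twmor f e h).
Proof. by case=> gh hg; split; rewrite -twmorM ?gh ?hg twmor_id. Qed.

Lemma twmor_iso e X Y (g : mor X Y) : is_iso g -> is_iso (twmor f e g).
Proof. by case=> h gh; exists (twmor f e h); apply: twmor_inverse. Qed.

(** The next three families factor the tensorator: [shift] moves the bracket of
T_e X ⊗ W, [pass] moves X past the f of T_e W, and [fuse] evaluates two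
copies of f. Each has a trivial and a non-trivial case, so that identities between them
hold for all labels and the associativity of the tensorator needs no
case distinction. *)
Definition shift e X W : mor (twob f e X ⊗ W) (twob f e (X ⊗ W)) :=
  if e return mor (twob f e X ⊗ W) (twob f e (X ⊗ W)) then asc f X W
  else idm (X ⊗ W).

Lemma shift_nat e X X' W W' (g : mor X X') (h : mor W W') :
  shift e X' W' ∘ (twmor f e g ⊠ h) = twmor f e (g ⊠ h) ∘ shift e X W.
Proof. by case: e; rewrite /= ?asc_nat // comp1m compm1. Qed.

Lemma shift_asc e X V W :
  twmor f e (asc X V W) ∘ (shift e (X ⊗ V) W ∘ (shift e X V ⊠ idm W))
  = shift e X (V ⊗ W) ∘ asc (twob f e X) V W.
Proof. by case: e; rewrite /= ?pentagonr // tensm_id !compm1 comp1m. Qed.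

Lemma shift_run e X :
  twmor f e (run X) ∘ shift e X 𝟙 = run (twob f e X).
Proof. by case: e; rewrite /= ?run_tens // compm1. Qed.

Lemma shift_iso e X W : is_iso (shift e X W).
Proof. by case: e; [exists (asci f X W); apply: ascK | apply: is_iso_id]. Qed.

Variable (c : mor (f ⊗ f) 𝟙).

Definition fuse e e' W : mor (twob f e (twob f e' W)) (twob f (e (+) e') W) :=
  match e, e' return mor (twob f e (twob f e' W)) (twob f (e (+) e') W) with
  | true, true => cap c W
  | true, false => idm (f ⊗ W)
  | false, true => idm (f ⊗ W)
  | false, false => idm W
  end.

Lemma fuse_nat e e' W W' (g : mor W W') :
  twmor f (e (+) e') g ∘ fuse e e' W = fuse e e' W' ∘ twmor f e (twmor f e' g).
Proof. by case: e e' => [] [] /=; rewrite ?cap_nat // comp1m compm1. Qed.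

Lemma shift_fuse e e' V W :
  shift (e (+) e') V W ∘ (fuse e e' V ⊠ idm W)
  = fuse e e' (V ⊗ W) ∘ (twmor f e (shift e' V W) ∘ shift e (twob f e' V) W).
Proof.
case: e e' => [] [] /=; rewrite ?tensm_id ?comp1m ?compm1 //.
by rewrite compmA cap_tens.
Qed.

Lemma fuse_iso e e' W : is_iso c -> is_iso (fuse e e' W).
Proof.
case=> d cd; case: e e' => [] [] /=; try exact: is_iso_id.
by exists (cup d W); apply: cap_cupK.
Qed.

(** The sides of associativity live in T_((e+e')+e'') W and T_(e+(e'+e'')) W,
which are convertible only for concrete labels. Composing with an arbitrary
family i, indexed by all labels, allows the statement without a cast. The
hypothesis says that f ⊗ f ⊗ f cancels in the same way from both sides. *)
Lemma fuse_assoc e e' e'' V W (i : forall a, mor (twob f a W) V) :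
  cap c (f ⊗ W) = idm f ⊠ cap c W ->
  i _ ∘ (fuse (e (+) e') e'' W ∘ fuse e e' (twob f e'' W))
  = i _ ∘ (fuse e (e' (+) e'') W ∘ twmor f e (fuse e' e'' W)).
Proof.
by move=> cW; case: e e' e'' => [] [] [] /=; rewrite ?tensm_id ?comp1m ?compm1
  ?cW.
Qed.

End Whiskering.

Section Coherence.
Variables (k : fieldType) (C : braidedCat k) (f : C) (c : mor (f ⊗ f) 𝟙).
Implicit Types V W X Y Z : C.

Definition pass e X W : mor (X ⊗ twob f e W) (twob f e (X ⊗ W)) :=
  if e return mor (X ⊗ twob f e W) (twob f e (X ⊗ W)) then swap f X W
  else idm (X ⊗ W).

Lemma pass_nat e X X' W W' (g : mor X X') (h : mor W W') :
  twmor f e (g ⊠ h) ∘ pass e X W = pass e X' W' ∘ (g ⊠ twmor f e h).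
Proof. by case: e; rewrite /= ?swap_nat // comp1m compm1. Qed.

Lemma pass_iso e X W : is_iso (pass e X W).
Proof. by case: e; [exact: swap_iso | exact: is_iso_id]. Qed.

Lemma pass_tens e X Y Z :
  twmor f e (asc X Y Z) ∘ pass e (X ⊗ Y) Z
  = pass e X (Y ⊗ Z) ∘ ((idm X ⊠ pass e Y Z) ∘ asc X Y (twob f e Z)).
Proof.
by case: e; rewrite /= ?swap_tensl // tensm_id !comp1m compm1.
Qed.

Lemma pass_shift e X V W :
  twmor f e (asc X V W) ∘ (shift f e (X ⊗ V) W ∘ (pass e X V ⊠ idm W))
  = pass e X (V ⊗ W) ∘ ((idm X ⊠ shift f e V W) ∘ asc X (twob f e V) W).
Proof.
by case: e; rewrite /= ?swap_asc_tens // !tensm_id !comp1m !compm1.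
Qed.

Lemma pass_fuse e e' X W :
  fuse c e e' (X ⊗ W) ∘ (twmor f e (pass e' X W) ∘ pass e X (twob f e' W))
  = pass (e (+) e') X W ∘ (idm X ⊠ fuse c e e' W).
Proof.
case: e e' => [] [] /=; rewrite ?tensm_id ?comp1m ?compm1 //.
exact: cap_swapr.
Qed.

Lemma pass_lun e X : twmor f e (lun X) ∘ pass e 𝟙 X = lun (twob f e X).
Proof. by case: e; rewrite /= ?swap_lun // compm1. Qed.

Lemma twtauE e e' X Y :
  twtau c e e' X Y
  = fuse c e e' (X ⊗ Y)
    ∘ (twmor f e (pass e' X Y) ∘ shift f e X (twob f e' Y)).
Proof.
case: e e' => [] [] /=; rewrite ?swap.unlock ?tensm_id ?comp1m ?compm1 //.
by rewrite cap.unlock !compAr.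
Qed.

Lemma twtau_iso e e' X Y : is_iso c -> is_iso (twtau c e e' X Y).
Proof.
move=> ic; rewrite twtauE; apply: is_iso_comp; last exact: fuse_iso.
by apply: is_iso_comp; [exact: shift_iso | exact/twmor_iso/pass_iso].
Qed.

Lemma twtau_nat e e' X X' Y Y' (g : mor X X') (h : mor Y Y') :
  twmor f (e (+) e') (g ⊠ h) ∘ twtau c e e' X Y
  = twtau c e e' X' Y' ∘ (twmor f e g ⊠ twmor f e' h).
Proof.
rewrite !twtauE !compAr (reassoc (fuse_nat _ _ _ _)) !compAr shift_nat.
by rewrite (reassoc (esym (twmorM _ _ _ _))) pass_nat twmorM !compAr.
Qed.

Lemma twtau_lun e X :
  twmor f e (lun X) ∘ twtau c false e 𝟙 X = lun (twob f e X).
Proof. by rewrite twtauE /= -(pass_lun e X); case: e; rewrite /= !comp1m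
  !compm1. Qed.

Lemma twtau_run e X V (i : forall a, mor (twob f a X) V) :
  i _ ∘ (twmor f _ (run X) ∘ twtau c e false X 𝟙) = i e ∘ run (twob f e X).
Proof.
rewrite -(shift_run f e X) twtauE.
by case: e; rewrite /= ?tensm_id ?comp1m ?compm1.
Qed.

(** The middle part of the associativity computation: Z's copy of f passes
X ⊗ Y as a whole on the left-hand side, and one factor at a time on the
right-hand side. *)
Lemma pass_pass_shift e e' X Y Z :
  twmor f e (twmor f e' (asc X Y Z)) ∘ (twmor f e (pass e' (X ⊗ Y) Z)
    ∘ (shift f e (X ⊗ Y) (twob f e' Z) ∘ (pass e X Y ⊠ idm _)))
  = twmor f e (pass e' X (Y ⊗ Z)) ∘ (pass e X (twob f e' (Y ⊗ Z))
    ∘ ((idm X ⊠ (twmor f e (pass e' Y Z) ∘ shift f e Y (twob f e' Z)))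
    ∘ asc X (twob f e Y) (twob f e' Z))).
Proof.
rewrite (reassoc (esym (twmorM _ _ _ _))) pass_tens !twmorM !compAr.
rewrite pass_shift (reassoc (pass_nat _ _ _)) !compAr.
by rewrite (reassoc (esym (tensmMr _ _ _))).
Qed.

(** Associativity of the tensorator, for all objects and all labels; the family
i plays the same role as in [fuse_assoc]. Both sides are brought to the form:
move everything past the copies of f, then fuse them. *)
Lemma twtau_assoc e e' e'' X Y Z V
    (i : forall a, mor (twob f a (X ⊗ Y ⊗ Z)) V) :
  (forall W, cap c (f ⊗ W) = idm f ⊠ cap c W) ->
  i _ ∘ (twmor f _ (asc X Y Z) ∘ (twtau c (e (+) e') e'' (X ⊗ Y) Z
    ∘ (twtau c e e' X Y ⊠ idm (twob f e'' Z))))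
  = i _ ∘ (twtau c e (e' (+) e'') X (Y ⊗ Z)
    ∘ ((idm (twob f e X) ⊠ twtau c e' e'' Y Z) ∘ asc _ _ _)).
Proof.
move=> cW; rewrite !twtauE !tensmMl !compAr.
rewrite (reassoc (fuse_nat _ _ _ _)) !compAr (reassoc (shift_fuse _ _ _ _ _)).
rewrite !compAr (reassoc (shift_nat _ _ _ _)) !compAr.
rewrite !(reassoc (fuse_nat _ _ _ _)) !compAr.
rewrite (reassoc (fuse_nat _ _ _ _)) !compAr.
rewrite 3!(reassoc (esym (twmorM _ e _ _))) !compAr pass_pass_shift !twmorM.
rewrite !compAr shift_asc (reassoc (esym (shift_nat _ _ _ _))) !compAr twmor_id.
rewrite (reassoc3 (fuse_assoc _ _ _ _ (cW _))) !compAr.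
congr (_ ∘ (_ ∘ _)).
rewrite 2!(reassoc (esym (twmorM _ e _ _))) !compAr pass_fuse twmorM !compAr.
congr (_ ∘ _); rewrite tensmMr !compAr.
rewrite (reassoc (esym (shift_nat _ _ _ _))) twmor_id compAr.
by rewrite !tensmMr !compAr.
Qed.

End Coherence.

(** * The monodromy and the grading *)

(** Fullness of f ⊗ -: conjugating id_f ⊠ h by f ⊗ f ≅ 𝟙 gives the preimage
of h. *)
HB.lock Definition unwhisker (k : fieldType) (C : braidedCat k) (f : C)
    (c : mor (f ⊗ f) 𝟙) (d : mor 𝟙 (f ⊗ f)) (X Y : C)
    (h : mor (f ⊗ X) (f ⊗ Y)) : mor X Y :=
  cap c Y ∘ ((idm f ⊠ h) ∘ cup d X).

Definition monodromy (k : fieldType) (C : braidedCat k) (f : C)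
    (c : mor (f ⊗ f) 𝟙) (d : mor 𝟙 (f ⊗ f)) (X : C) : mor X X :=
  unwhisker c d (br X f ∘ br f X).

Section Monodromy.
Variables (k : fieldType) (C : braidedCat k) (f : C).
Variables (c : mor (f ⊗ f) 𝟙) (d : mor 𝟙 (f ⊗ f)).
Hypothesis cd : inverse_pair c d.
Implicit Types V W X Y Z : C.

Lemma cap_iso W : is_iso (cap c W).
Proof. by exists (cup d W); apply: cap_cupK. Qed.

Lemma cap_mono W : is_mono (cap c W). Proof. exact/iso_mono/cap_iso. Qed.
Lemma cap_epi W : is_epi (cap c W). Proof. exact/iso_epi/cap_iso. Qed.

Lemma whisker_inj X Y (g h : mor X Y) : idm f ⊠ g = idm f ⊠ h -> g = h.
Proof. by move=> gh; apply: cap_epi; rewrite -!cap_nat gh. Qed.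

Lemma unwhiskerK X Y (h : mor (f ⊗ X) (f ⊗ Y)) : idm f ⊠ unwhisker c d h = h.
Proof.
apply: whisker_inj; apply: cap_mono; rewrite cap_nat unwhisker.unlock !compAr.
by have [-> _] := cap_cupK X cd; rewrite compm1.
Qed.

Local Notation monodromy := (monodromy c d).

Lemma monodromyE X : idm f ⊠ monodromy X = br X f ∘ br f X.
Proof. exact: unwhiskerK. Qed.

Lemma monodromy_nat X Y (g : mor X Y) : monodromy Y ∘ g = g ∘ monodromy X.
Proof.
apply: whisker_inj; rewrite !tensmMr !monodromyE !compAr br_nat.
by rewrite (reassoc (br_nat _ _)) !compAr.
Qed.

Lemma swap_swap X W : swap f X W ∘ swap X f W = idm f ⊠ (monodromy X ⊠ idm W).
Proof.
apply: asc_epi; rewrite !compAr swap_asc (reassoc (swap_asc _ _ _)) !compAr.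
by rewrite -tensmMl -monodromyE asc_nat.
Qed.

(** Pull the cap on f ⊗ f across X and back by the braiding. Naturality says
that nothing changes, while each copy of f has contributed one m_X. *)
Lemma monodromy_sq X : monodromy X ∘ monodromy X = idm X.
Proof.
apply: tensm_unit_inj; apply: whisker_inj; apply: whisker_inj; apply: cap_mono.
rewrite tensm_id tensm_id tensm_id compm1 -[RHS](@cap_swapl _ _ _ _ c).
rewrite -(@cap_swapr _ _ _ _ c) !compAr (reassoc (swap_swap _ _)).
rewrite -!tensmMr; congr (_ ∘ (_ ⊠ _)).
rewrite -(tensm_id f 𝟙) swap_nat (reassoc (swap_swap _ _)).
by rewrite -tensmMr -tensmMl.
Qed.

(** By the hexagons, the double braiding with X ⊗ Y is the one with Y inside the
one with X; naturality of the swap takes m_Y out. *)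
Lemma monodromy_tens X Y : monodromy (X ⊗ Y) = monodromy X ⊠ monodromy Y.
Proof.
apply: tensm_unit_inj; apply: asc_mono; rewrite asc_nat; apply: whisker_inj.
rewrite !tensmMr -swap_swap (reassoc (swap_tensl _ _ _ _)) !compAr.
rewrite swap_tensr (reassoc (esym (tensmMr X _ _))) swap_swap.
rewrite (reassoc (esym (swap_nat _ _ _))) !compAr (reassoc (swap_swap _ _)).
by rewrite compmA -!tensmMr -tensm_rl.
Qed.

Lemma monodromy_unit : monodromy 𝟙 = idm 𝟙.
Proof.
apply: whisker_inj; rewrite monodromyE tensm_id; apply: run_mono.
by rewrite (reassoc (run_br _)) lun_br compm1.
Qed.

Lemma in_degreeE (e : bool) X :
  in_degree f e X <-> monodromy X = (-1) ^+ e *: idm X.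
Proof.
have -> : in_degree f e X = (br X f = (-1) ^+ e *: bri f X).
  by rewrite /in_degree; case: e; rewrite ?expr1 ?scaleN1r ?expr0 ?scale1r.
split=> hX.
- by apply: whisker_inj; rewrite monodromyE hX compZl brKl tensmZr tensm_id.
- rewrite -[br X f]compm1 -(brKr f X) compmA -monodromyE hX.
  by rewrite tensmZr tensm_id compZl comp1m.
Qed.

Lemma in_degree_tens a b X Y :
  in_degree f a X -> in_degree f b Y -> in_degree f (a (+) b) (X ⊗ Y).
Proof.
move=> /in_degreeE hX /in_degreeE hY; apply/in_degreeE.
by rewrite monodromy_tens hX hY tensmZl tensmZr tensm_id scalerA -signr_addb.
Qed.

Lemma in_degree_unit : in_degree f false 𝟙.
Proof. by apply/in_degreeE; rewrite monodromy_unit expr0 scale1r. Qed.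

Section SelfBraiding.
Variable t : k.
Hypotheses (br_ff : br f f = t *: idm _) (t_sq : t * t = 1).

Lemma in_degree_self : in_degree f false f.
Proof.
apply/in_degreeE; apply: whisker_inj; rewrite monodromyE br_ff.
by rewrite compZl compZr comp1m scalerA t_sq expr0 !scale1r tensm_id.
Qed.

Lemma swap_self W : swap f f W = t *: idm _.
Proof. by rewrite swapE br_ff tensmZl compZl compZr tensm_id comp1m ascKr. Qed.

(** Pulling f itself through the cap on f ⊗ f costs two self-braidings, that is
t^2 = 1. This is the vanishing of the associator obstruction of f. *)
Lemma cap_self W : cap c (f ⊗ W) = idm f ⊠ cap c W.
Proof.
rewrite -cap_swapr !swap_self compZr tensmZr tensm_id compZl comp1m scalerA.
by rewrite t_sq scale1r compm1.
Qed.

Lemma swap_swap_degree (a : bool) X W :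
  in_degree f a X -> swap f X W ∘ swap X f W = (-1) ^+ a *: idm _.
Proof.
by move/in_degreeE=> hX; rewrite swap_swap hX tensmZl tensmZr !tensm_id.
Qed.

(** The sign that decides the theorem. In degree (1, 1) one crossing of two
copies of f contributes t, and the double braiding of f with Y contributes -1.
As in [fuse_assoc], the family i avoids a cast between a + b and b + a. *)
Lemma twtau_br (a b : bool) X Y V (i : forall a, mor (twob f a (Y ⊗ X)) V) :
  in_degree f a X -> in_degree f b Y ->
  i _ ∘ (twtau c b a Y X ∘ br (twob f a X) (twob f b Y))
  = (if a && b then - t else 1)
    *: (i _ ∘ (twmor f _ (br X Y) ∘ twtau c a b X Y)).
Proof.
rewrite !twtauE.
case: a b => [] [] /= hX hY; rewrite ?tensm_id ?comp1m ?compm1 ?scale1r //.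
- rewrite !compAr br_tensr (reassoc (ascKr _ _ _)) comp1m.
  rewrite (reassoc (esym (tensmMr _ _ _))) br_tensl (reassoc (swap_swap_degree
    _ hY)).
  rewrite compZl comp1m tensmZr tensmMr compZl compAr swap_tensl swap_self.
  rewrite compZl !compZr scalerA expr1 mulN1r.
  by rewrite comp1m (reassoc (cap_nat _ _)) compAr.
- by rewrite br_tensl (reassoc (swap_swap_degree _ hY)) ?expr0 ?scale1r ?comp1m.
- by rewrite br_tensr (reassoc (ascKr _ _ _)) comp1m.
Qed.

End SelfBraiding.

Hypothesis char2 : 2%:R != 0 :> k.

Definition proj (e : bool) X : mor X X :=
  2^-1 *: (idm X + (-1) ^+ e *: monodromy X).

Lemma proj_nat e X Y (g : mor X Y) : proj e Y ∘ g = g ∘ proj e X.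
Proof.
by rewrite compZl compZr compDl compDr compZl compZr monodromy_nat comp1m
  compm1.
Qed.

(** Reduces orthogonality and multiplicativity of the projections to the
corresponding eigenvalues of the monodromy. *)
Lemma proj_eigen (e a : bool) X Y (g : mor X Y) :
  monodromy Y ∘ g = (-1) ^+ a *: g ->
  proj e Y ∘ g = if e == a then g else 0.
Proof.
move=> hg; rewrite compZl compDl comp1m compZl hg scalerA -signr_addb.
case: e a hg => [] [] _ /=; rewrite ?expr0 ?expr1 ?scale1r ?scaleN1r ?subrr
  ?scaler0 //.
all: by rewrite -mulr2n -scaler_nat scalerA mulVf ?scale1r.
Qed.

Lemma monodromy_proj e X : monodromy X ∘ proj e X = (-1) ^+ e *: proj e X.
Proof.
rewrite compZr compDr compm1 compZr monodromy_sq scalerA mulrC -scalerA.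
congr (_ *: _); rewrite scalerDr scalerA -signr_addb addbb expr0 scale1r.
exact: addrC.
Qed.

Lemma proj_proj e a X : proj e X ∘ proj a X = if e == a then proj a X else 0.
Proof. exact/proj_eigen/monodromy_proj. Qed.

Lemma proj_idem e X : proj e X ∘ proj e X = proj e X.
Proof. by rewrite proj_proj eqxx. Qed.

Lemma proj_sum X : proj false X + proj true X = idm X.
Proof.
rewrite -scalerDr expr0 expr1 scale1r scaleN1r addrACA subrr addr0.
by rewrite -mulr2n -scaler_nat scalerA mulVf ?scale1r.
Qed.

Lemma proj_degree (e a : bool) X :
  in_degree f a X -> proj e X = if e == a then idm X else 0.
Proof. by move/in_degreeE=> hX; rewrite -[LHS]compm1 (@proj_eigen e a)
  ?compm1. Qed.

Lemma proj_tens e a b X Y :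
  proj e (X ⊗ Y) ∘ (proj a X ⊠ proj b Y)
  = if e == a (+) b then proj a X ⊠ proj b Y else 0.
Proof.
apply: proj_eigen; rewrite monodromy_tens -tensm_comp !monodromy_proj.
by rewrite tensmZl tensmZr scalerA -signr_addb.
Qed.

Lemma proj_tens_sum e X Y :
  proj e (X ⊗ Y)
  = proj false X ⊠ proj e Y + proj true X ⊠ proj (~~ e) Y.
Proof.
rewrite -[LHS]compm1 -tensm_id -!proj_sum tensmDl !tensmDr !compDr !proj_tens.
by case: e; rewrite /= ?addr0 ?add0r // addrC.
Qed.

End Monodromy.

(** * The twisting functor *)

Section Resolutions.
Variables (k : fieldType).

Lemma comp_sumr (C : linCat k) (X Y Z : C) (I : finType) (g : mor Y Z)
    (u : I -> mor X Y) :
  g ∘ (\sum_i u i) = \sum_i g ∘ u i.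
Proof. exact: (big_morph _ (compDr g) (comp0r _ g)). Qed.

Lemma comp_suml (C : linCat k) (X Y Z : C) (I : finType) (g : mor X Y)
    (u : I -> mor Y Z) :
  (\sum_i u i) ∘ g = \sum_i u i ∘ g.
Proof. exact: (big_morph _ (fun a b => compDl a b g) (comp0l _ g)). Qed.

(** Unlike in a direct sum, h i ∘ g i need not be the identity: X and f ⊗ X
themselves can then serve as the summands of F X, in place of X_+ and
f ⊗ X_-. *)
Definition resolves (C : linCat k) (X : C) (I : finType) (V : I -> C)
    (g : forall i, mor (V i) X) (h : forall i, mor X (V i)) : Prop :=
  \sum_i g i ∘ h i = idm X.

Lemma resolves_epi (C : linCat k) (X Y : C) (I : finType) (V : I -> C)
    (g : forall i, mor (V i) X) h (u v : mor X Y) :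
  resolves g h -> (forall i, u ∘ g i = v ∘ g i) -> u = v.
Proof.
move=> gh uv; rewrite -[u]compm1 -[v]compm1 -gh !comp_sumr.
by apply: eq_bigr => i _; rewrite !compmA uv.
Qed.

Lemma resolves_id (C : linCat k) (X : C) :
  resolves (fun _ : unit => idm X) (fun _ : unit => idm X).
Proof. by rewrite /resolves (big_pred1 tt) ?comp1m // => [[]]. Qed.

Lemma resolves_tens (C : monCat k) (X Y : C) (I J : finType)
    (V : I -> C) (W : J -> C) (g : forall i, mor (V i) X) h
    (g' : forall j, mor (W j) Y) h' :
  resolves g h -> resolves g' h' ->
  @resolves C (X ⊗ Y) (I * J)%type (fun ij => V ij.1 ⊗ W ij.2)
    (fun ij => g ij.1 ⊠ g' ij.2) (fun ij => h ij.1 ⊠ h' ij.2).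
Proof.
move=> gh gh'; rewrite /resolves.
rewrite -(pair_bigA _ (fun i j => (g i ⊠ g' j) ∘ (h i ⊠ h' j))) /=.
rewrite -[RHS]tensm_id -gh -gh'.
rewrite (big_morph (fun u => u ⊠ _) (fun a b => tensmDl a b _) (tensm0l _ _ _)).
apply: eq_bigr => i _.
rewrite (big_morph (fun u => _ ⊠ u) (fun a b => tensmDr _ a b) (tensm0r _ _ _)).
by apply: eq_bigr => j _; rewrite tensm_comp.
Qed.

End Resolutions.

Section TwistedFunctor.
Variables (k : fieldType) (C : braidedCat k) (f : C).
Variables (c : mor (f ⊗ f) 𝟙) (d : mor 𝟙 (f ⊗ f)).
Hypothesis cd : inverse_pair c d.
Hypothesis char2 : 2%:R != 0 :> k.
Variable t : k.
Hypotheses (br_ff : br f f = t *: idm _) (t_sq : t * t = 1).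
Implicit Types V W X Y Z : C.

Local Notation p := (proj c d).
Local Notation T := (twmor f).

(** An object playing the role of X_+ ⊕ f ⊗ X_-, described through maps from and
to T_e X: the composite on T_e X is not the identity but the projection to
degree e. *)
Record twisted_ob X := TwistedOb {
  tob : C;
  tin : forall e, mor (twob f e X) tob;
  tout : forall e, mor tob (twob f e X);
  tin_out : resolves tin tout;
  tout_in : forall e, tout e ∘ tin e = T e (p e X);
  tout_in0 : forall a b, a != b -> tout a ∘ tin b = 0
}.

Variable D : forall X, twisted_ob X.
Local Notation F X := (tob (D X)).
Local Notation "'ι' e X" := (tin (D X) e) (at level 10, e, X at level 9).
Local Notation "'π' e X" := (tout (D X) e) (at level 10, e, X at level 9).

Lemma tin_proj e X : ι e X ∘ T e (p e X) = ι e X.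
Proof.
rewrite -(tout_in (D X)) -[RHS]comp1m -(tin_out (D X)) comp_suml (bigD1 e) //=.
rewrite big1 ?addr0 ?compAr // => a ae.
by rewrite compAr tout_in0 // comp0r.
Qed.

Definition tmap X Y (g : mor X Y) : mor (F X) (F Y) :=
  \sum_e ι e Y ∘ (T e g ∘ π e X).

Lemma tmap_in e X Y (g : mor X Y) : tmap g ∘ ι e X = ι e Y ∘ T e g.
Proof.
rewrite /tmap comp_suml (bigD1 e) //= big1 ?addr0 => [|a ae].
  by rewrite !compAr tout_in -twmorM -proj_nat // twmorM compmA tin_proj.
by rewrite !compAr tout_in0 // !comp0r.
Qed.

Lemma tin_epi X V (u v : mor (F X) V) :
  (forall e, u ∘ ι e X = v ∘ ι e X) -> u = v.
Proof. exact: resolves_epi (tin_out (D X)). Qed.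

Lemma tmap_id X : tmap (idm X) = idm (F X).
Proof. by apply: tin_epi => e; rewrite tmap_in twmor_id comp1m compm1. Qed.

Lemma tmapM X Y Z (g : mor Y Z) (h : mor X Y) : tmap (g ∘ h) = tmap g ∘ tmap h.
Proof.
by apply: tin_epi => e; rewrite compAr !tmap_in compmA tmap_in twmorM compAr.
Qed.

Definition twisting_functor : functor C C :=
  @Functor k C C (fun X => F X) tmap tmap_id tmapM.

Lemma twisting_linear : linear_functor twisting_functor.
Proof.
move=> X Y a u v /=; apply: tin_epi => e.
by rewrite compDl compZl !tmap_in twmorD twmorZ compDr compZr.
Qed.

Definition ttau X Y : mor (F X ⊗ F Y) (F (X ⊗ Y)) :=
  \sum_(ab : bool * bool) ι (ab.1 (+) ab.2) (X ⊗ Y)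
    ∘ (twtau c ab.1 ab.2 X Y ∘ (π (ab.1) X ⊠ π (ab.2) Y)).

Lemma tin_epi2 X Y V (u v : mor (F X ⊗ F Y) V) :
  (forall a b, u ∘ (ι a X ⊠ ι b Y) = v ∘ (ι a X ⊠ ι b Y)) -> u = v.
Proof.
move=> uv; apply: (resolves_epi (resolves_tens (tin_out (D X)) (tin_out (D
  Y)))).
by case=> a b; apply: uv.
Qed.

Lemma tin_epi3 X Y Z V (u v : mor ((F X ⊗ F Y) ⊗ F Z) V) :
  (forall a b e,
    u ∘ ((ι a X ⊠ ι b Y) ⊠ ι e Z) = v ∘ ((ι a X ⊠ ι b Y) ⊠ ι e Z)) ->
  u = v.
Proof.
move=> uv; apply: (resolves_epi (resolves_tens (resolves_tens (tin_out (D X))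
  (tin_out (D Y))) (tin_out (D Z)))).
by case=> [[a b] e]; apply: uv.
Qed.

(** The projections on the right appear because the summands of F X are cut out
of X and f ⊗ X. *)
Lemma ttau_in a b X Y :
  ttau X Y ∘ (ι a X ⊠ ι b Y)
  = ι (a (+) b) (X ⊗ Y) ∘ (twtau c a b X Y ∘ (T a (p a X) ⊠ T b (p b Y))).
Proof.
rewrite /ttau comp_suml (bigD1 (a, b)) //= big1 ?addr0 => [|[a' b'] ab].
  by rewrite !compAr -tensm_comp !tout_in.
rewrite !compAr -tensm_comp; have [aa|aa] := boolP (a' == a); last first.
  by rewrite (tout_in0 (D X)) //= tensm0l !comp0r.
rewrite (tout_in0 (D Y) (b := b)) ?tensm0r ?comp0r //=.
by apply: contra ab => bb; rewrite xpair_eqE aa.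
Qed.

Lemma twtau_proj a b X Y :
  T (a (+) b) (p (a (+) b) (X ⊗ Y))
    ∘ (twtau c a b X Y ∘ (T a (p a X) ⊠ T b (p b Y)))
  = twtau c a b X Y ∘ (T a (p a X) ⊠ T b (p b Y)).
Proof. by rewrite -twtau_nat compmA -twmorM proj_tens // eqxx. Qed.

Lemma ttau_nat X X' Y Y' (g : mor X X') (h : mor Y Y') :
  tmap (g ⊠ h) ∘ ttau X Y = ttau X' Y' ∘ (tmap g ⊠ tmap h).
Proof.
apply: tin_epi2 => a b; rewrite !compAr ttau_in -tensm_comp !tmap_in tensm_comp.
rewrite (reassoc (tmap_in _ _)) !compAr (reassoc (ttau_in _ _ _ _)) !compAr.
rewrite (reassoc (twtau_nat _ _ _ _ _)) !compAr -!tensm_comp -!twmorM.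
by rewrite !proj_nat.
Qed.

Lemma ttau_asc X Y Z :
  tmap (asc X Y Z) ∘ ttau (X ⊗ Y) Z ∘ (ttau X Y ⊠ idm (F Z))
  = ttau X (Y ⊗ Z) ∘ (idm (F X) ⊠ ttau Y Z) ∘ asc (F X) (F Y) (F Z).
Proof.
apply: tin_epi3 => a b e; rewrite !compAr asc_nat.
rewrite -tensm_comp ttau_in comp1m.
rewrite (reassoc (esym (tensm_comp _ _ _ _))) ttau_in comp1m.
rewrite -[ι e Z]compm1 -[ι a X in RHS]compm1 !tensm_comp.
rewrite !(reassoc (ttau_in _ _ _ _)) !compAr (reassoc (tmap_in _ _)) !compAr.
rewrite -!tensm_comp compm1.
rewrite twtau_proj -[T e (p e Z)]comp1m tensm_comp.
rewrite (reassoc4 (twtau_assoc _ _ _ (fun e => ι e _) (cap_self c br_ff t_sq))).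
rewrite comp1m !compAr asc_nat.
rewrite (reassoc (ttau_in _ _ _ _)) !compAr; congr (_ ∘ (_ ∘ _)).
rewrite !(reassoc (esym (tensm_comp _ _ _ _))) compm1 comp1m twtau_proj.
by congr (_ ∘ _); rewrite -[in RHS](comp1m (_ (p a X))) tensm_comp.
Qed.

Lemma tin_degree e X : in_degree f e X -> is_iso (ι e X).
Proof.
move=> hX; exists (π e X); split.
  by rewrite tout_in (proj_degree _ _ _ hX) // eqxx twmor_id.
rewrite -(tin_out (D X)) (bigD1 e) //= big1 ?addr0 // => a ae.
rewrite -tin_proj (proj_degree _ _ _ hX) // (negPf ae) twmor0.
by rewrite comp0r comp0l.
Qed.

Lemma ttau_lun X :
  tmap (lun X) ∘ ttau 𝟙 X ∘ (ι false 𝟙 ⊠ idm (F X)) = lun (F X).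
Proof.
apply: (resolves_epi (resolves_tens (resolves_id (𝟙 : C)) (tin_out (D X)))).
case=> [[] e] /=; rewrite lun_nat !compAr -tensm_comp comp1m compm1 (ttau_in
  false e).
rewrite (reassoc (tmap_in _ _)) !compAr (reassoc (twtau_lun _ _ _)) /=.
rewrite (proj_degree _ _ _ (in_degree_unit cd)) //= lun_nat.
by rewrite compmA tin_proj.
Qed.

Lemma ttau_run X :
  tmap (run X) ∘ ttau X 𝟙 ∘ (idm (F X) ⊠ ι false 𝟙) = run (F X).
Proof.
apply: (resolves_epi (resolves_tens (tin_out (D X)) (resolves_id (𝟙 : C)))).
case=> [e []] /=; rewrite run_nat !compAr -tensm_comp comp1m compm1 (ttau_in e
  false).
rewrite (reassoc (tmap_in _ _)) !compAr.
rewrite (reassoc3 (twtau_run _ _ (fun e => ι e X))) compAr /=.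
rewrite (proj_degree _ _ _ (in_degree_unit cd)) //= run_nat.
by rewrite compmA tin_proj.
Qed.

(** Passing through F X between two labels vanishes as soon as the components
that it connects are orthogonal. *)
Lemma tin_tout0 a b X (u v : mor X X) :
  (a = b -> u ∘ (p a X ∘ v) = 0) ->
  T a u ∘ (π a X ∘ (ι b X ∘ T b v)) = 0.
Proof.
have [-> uv|ab _] := eqVneq a b.
  by rewrite (reassoc (tout_in _ _)) -!twmorM uv ?twmor0.
by rewrite (reassoc (tout_in0 (D X) ab)) comp0l comp0r.
Qed.

(** The candidate inverse inverts the tensorator on each pair of components.
That it is a left inverse uses that components with different labels do not
mix, and that it is a right inverse uses that the projection of X ⊗ Y to degree
g is the sum of the products of projections with degrees adding up to g. *)
Lemma ttau_iso X Y : is_iso (ttau X Y).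
Proof.
have [w wE] : exists w : forall a b,
    mor (twob f (a (+) b) (X ⊗ Y)) (twob f a X ⊗ twob f b Y),
    forall a b, inverse_pair (twtau c a b X Y) (w a b).
  have w a b : {w | inverse_pair (twtau c a b X Y) w}.
    by apply: constructive_indefinite_description; apply: twtau_iso; exists d.
  by exists (fun a b => sval (w a b)) => a b; apply: (svalP (w a b)).
pose P a b := p a X ⊠ p b Y.
have tauP a b : ttau X Y ∘ (ι a X ⊠ ι b Y)
    = ι (a (+) b) (X ⊗ Y) ∘ (T (a (+) b) (P a b) ∘ twtau c a b X Y).
  by rewrite ttau_in twtau_nat.
exists (\sum_(ab : bool * bool) (ι (ab.1) X ⊠ ι (ab.2) Y)
  ∘ (w ab.1 ab.2 ∘ π (ab.1 (+) ab.2) (X ⊗ Y))); split.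
- apply: tin_epi2 => a b; rewrite comp1m compAr tauP comp_suml.
  rewrite (bigD1 (a, b)) //= big1 ?addr0 => [|[a' b'] ab] /=.
    rewrite !compAr (reassoc (tout_in _ _)) (reassoc (esym (twmorM _ _ _ _))).
    rewrite proj_tens // eqxx twtau_nat; have [wK _] := wE a b.
    by rewrite (reassoc wK) comp1m -tensm_comp !tin_proj.
  have -> : (ι a' X ⊠ ι b' Y) ∘ (w a' b' ∘ π (a' (+) b') (X ⊗ Y))
      = (ι a' X ⊠ ι b' Y)
        ∘ (w a' b' ∘ (T _ (P a' b') ∘ π (a' (+) b') (X ⊗ Y))).
    rewrite -{1}(tin_proj a' X) -{1}(tin_proj b' Y) tensm_comp !compAr.
    congr (_ ∘ _); rewrite !compmA; congr (_ ∘ _).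
    have [_ Kw] := wE a' b'; apply: (inv_mono (wE a' b')).
    by rewrite !compmA -twtau_nat Kw comp1m compAr Kw compm1.
  have tt0 : T _ (P a' b') ∘ (π (a' (+) b') (X ⊗ Y)
      ∘ (ι (a (+) b) (X ⊗ Y) ∘ T _ (P a b))) = 0.
    2: by rewrite !compAr (reassoc4 tt0) comp0l !comp0r.
  apply: tin_tout0 => _; rewrite proj_tens // fun_if comp0r -tensm_comp
    !proj_proj //.
  case: eqP => // _; move: ab; rewrite xpair_eqE negb_and.
  by case/orP=> /negPf ->; rewrite ?tensm0l ?tensm0r.
- rewrite comp_sumr -(tin_out (D (X ⊗ Y))) big_bool.
  rewrite (eq_bigr (fun ab => ι (ab.1 (+) ab.2) (X ⊗ Y)
     ∘ (T _ (P ab.1 ab.2) ∘ π (ab.1 (+) ab.2) (X ⊗ Y)))).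
    rewrite -(pair_bigA _ (fun a b => ι (a (+) b) (X ⊗ Y)
      ∘ (T _ (P a b) ∘ π (a (+) b) (X ⊗ Y)))) /= big_bool /= !big_bool /=.
    rewrite -[in RHS](tin_proj true) -[in RHS](tin_proj false (X ⊗ Y)).
    rewrite !(proj_tens_sum cd char2).
    rewrite !twmorD !compDr !compDl /= !compAr addrC [X in _ + X]addrC.
    by rewrite addrACA.
  case=> a b _ /=; rewrite compmA tauP !compAr; congr (_ ∘ (_ ∘ _)).
  by have [_ Kw] := wE a b; rewrite (reassoc Kw) comp1m.
Qed.

Definition twisting : monFunctor C C :=
  @MonFunctor k C C twisting_functor ttau (ι false 𝟙) ttau_iso
    (tin_degree (in_degree_unit cd)) ttau_nat ttau_asc ttau_lun ttau_run.

Lemma twisting_is_twisting : is_twisting_functor c twisting.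
Proof.
split; first exact: twisting_linear.
exists (fun e X _ => ι e X); split=> [e X|e X Y _ _ g|a b X Y hX hY _] /=.
- exact: tin_degree.
- exact: tmap_in.
- by rewrite ttau_in (proj_degree _ _ _ hX) // (proj_degree _ _ _ hY) // !eqxx
    !twmor_id tensm_id compm1.
Qed.

End TwistedFunctor.

(** * Splitting into homogeneous parts *)

(** [is_direct_sum] for an arbitrary finite index type. *)
Record splits (k : fieldType) (C : linCat k) (X : C) (I : finType) (V : I -> C)
    (i : forall e, mor (V e) X) (q : forall e, mor X (V e)) : Prop := Splits {
  splits_resolves : resolves i q;
  splits_id : forall e, q e ∘ i e = idm (V e);
  splits0 : forall a b, a != b -> q a ∘ i b = 0
}.

Definition inhabited_witness (A : Type) (iA : inhabited A) : A :=
  sval (constructive_indefinite_description (fun _ : A => True)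
    (let: inhabits a := iA in ex_intro _ a I)).

Section AbelianCategories.
Variables (k : fieldType) (C : linCat k).
Implicit Types X Y Z : C.
Hypothesis abC : abelian_cat C.

(** The image of p is the kernel of 1 - p. *)
Lemma split_idempotent X (p : mor X X) : p ∘ p = p ->
  exists Y (i : mor Y X) (q : mor X Y), q ∘ i = idm Y /\ i ∘ q = p.
Proof.
move=> pp; have [_ /(_ X X (idm X - p)) [[Y [i [pi iu]]] _] _ _] := abC.
have eqi : p ∘ i = i.
  by apply/esym/eqP; rewrite -subr_eq0 -compNl -{1}(comp1m i) -compDl pi.
have [|q [iq _]] := iu X p; first by rewrite compDl compNl comp1m pp subrr.
exists Y, i, q; split=> //.
have [|v [iv vu]] := iu Y i; first exact: pi.
by rewrite -(vu (idm Y) (compm1 i)); apply/esym/vu; rewrite compmA iq.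
Qed.

Lemma direct_sum_bool (V : bool -> C) :
  exists X (i : forall e, mor (V e) X) (p : forall e, mor X (V e)),
  splits i p.
Proof.
have [/(_ 2 (fun j => V (j != ord0))) [X [i [p [pi pi0 ip]]]] _ _ _] := abC.
pose o e : 'I_2 := if e then lift ord0 ord0 else ord0.
exists X, (fun e => if e return mor (V e) X then i (o true) else i (o false)).
exists (fun e => if e return mor X (V e) then p (o true) else p (o false)).
split=> [|[]|[] []] //.
- by rewrite /resolves big_bool -ip big_ord_recl big_ord1 addrC.
- exact: (pi (o true)).
- exact: (pi (o false)).
- by move=> _; apply: (pi0 (o true) (o false)).
- by move=> _; apply: (pi0 (o false) (o true)).
Qed.

End AbelianCategories.

Section LinearFunctors.
Variables (k : fieldType) (C D : linCat k) (F : functor C D).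
Hypothesis linF : linear_functor F.

Lemma fmorD (X Y : C) (g h : mor X Y) : fmor F (g + h) = fmor F g + fmor F h.
Proof. by have := linF 1 g h; rewrite !scale1r. Qed.

Lemma fmor0 (X Y : C) : fmor F (0 : mor X Y) = 0.
Proof. by apply: (addrI (fmor F 0)); rewrite -fmorD !addr0. Qed.

Lemma fmor_resolves (X : C) (I : finType) (V : I -> C)
    (g : forall i, mor (V i) X) h :
  resolves g h -> resolves (fun i => fmor F (g i)) (fun i => fmor F (h i)).
Proof.
move=> gh; rewrite /resolves -fmor_id -gh.
rewrite (big_morph _ (@fmorD X X) (fmor0 X X)).
by apply: eq_bigr => i _; rewrite fmor_comp.
Qed.

End LinearFunctors.

Lemma fmor_iso (k : fieldType) (C D : linCat k) (F : functor C D) (X Y : C)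
    (g : mor X Y) :
  is_iso g -> is_iso (fmor F g).
Proof.
by move=> [h [hg gh]]; exists (fmor F h); split; rewrite -fmor_comp ?hg ?gh
  fmor_id.
Qed.

Lemma fmor_splits (k : fieldType) (C D : linCat k) (F : functor C D) (X : C)
    (I : finType) (V : I -> C) (i : forall e, mor (V e) X) q :
  linear_functor F -> splits i q ->
  splits (fun e => fmor F (i e)) (fun e => fmor F (q e)).
Proof.
move=> linF [iq qi qi0]; split; first exact: fmor_resolves.
  by move=> e; rewrite -fmor_comp qi fmor_id.
by move=> a b ab; rewrite -fmor_comp qi0 // fmor0.
Qed.

Section Diagonal.
Variables (k : fieldType) (C : linCat k) (X Y : C) (I : finType).
Variables (V W : I -> C) (i : forall e, mor (V e) X).
Variables (q : forall e, mor X (V e)).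
Variables (i' : forall e, mor (W e) Y) (q' : forall e, mor Y (W e)).
Hypotheses (iq : splits i q) (iq' : splits i' q').

Lemma diagonal_in (u : forall e, mor (V e) (W e)) a :
  (\sum_e i' e ∘ (u e ∘ q e)) ∘ i a = i' a ∘ u a.
Proof.
rewrite comp_suml (bigD1 a) //= big1 ?addr0 => [|b ba].
  by rewrite !compAr (splits_id iq) compm1.
by rewrite !compAr (splits0 iq) // !comp0r.
Qed.

Lemma diagonal_inverse (u : forall e, mor (V e) (W e)) w :
  (forall e, w e ∘ u e = idm _) ->
  (forall a, (\sum_e i e ∘ (w e ∘ q' e)) ∘ i' a = i a ∘ w a) ->
  (\sum_e i e ∘ (w e ∘ q' e)) ∘ (\sum_e i' e ∘ (u e ∘ q e)) = idm X.
Proof.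
move=> wu win; apply: (resolves_epi (splits_resolves iq)) => a.
by rewrite compAr diagonal_in compmA win compAr wu compm1 comp1m.
Qed.

End Diagonal.

Lemma diagonal_iso (k : fieldType) (C : linCat k) (X Y : C) (I : finType)
    (V W : I -> C) (i : forall e, mor (V e) X) q (i' : forall e, mor (W e) Y) q'
    (u : forall e, mor (V e) (W e)) :
  splits i q -> splits i' q' -> (forall e, is_iso (u e)) ->
  is_iso (\sum_e i' e ∘ (u e ∘ q e)).
Proof.
move=> iq iq' iu.
have w e : {w | inverse_pair (u e) w}.
  by apply: constructive_indefinite_description; apply: iu.
exists (\sum_e i e ∘ (sval (w e) ∘ q' e)).
by split; apply: diagonal_inverse => //; try exact: diagonal_in;
  move=> e; have [] := svalP (w e).
Qed.

(** F is its own quasi-inverse, with the inverse of the unit eta as counit. *)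
Lemma involutive_equivalence (k : fieldType) (C : linCat k) (F : functor C C)
    (eta : forall X : C, mor X (F (F X))) :
  (forall X, is_iso (eta X)) ->
  (forall X Y (g : mor X Y), fmor F (fmor F g) ∘ eta X = eta Y ∘ g) ->
  equivalence F.
Proof.
move=> ieta neta.
have eps X : {w | inverse_pair (eta X) w}.
  exact/constructive_indefinite_description/ieta.
exists F, eta, (fun X => sval (eps X)); split=> //.
- by move=> X; exists (eta X); apply/inverse_pair_sym/(svalP (eps X)).
- move=> X Y g; have [we ew] := svalP (eps Y); have [we' ew'] := svalP (eps X).
  apply: (iso_mono (ieta Y)); rewrite !compmA ew comp1m -neta compAr ew'.
  by rewrite compm1.
Qed.

Section Homogeneous.
Variables (k : fieldType) (C : braidedCat k) (f : C).
Variables (c : mor (f ⊗ f) 𝟙) (d : mor 𝟙 (f ⊗ f)).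
Hypothesis cd : inverse_pair c d.
Hypothesis char2 : 2%:R != 0 :> k.
Hypothesis abC : abelian_cat C.
Implicit Types V W X Y Z : C.

Record homogeneous_parts X := HomogeneousParts {
  part : bool -> C;
  part_in : forall e, mor (part e) X;
  part_out : forall e, mor X (part e);
  part_splits : splits part_in part_out;
  part_proj : forall e, part_in e ∘ part_out e = proj c d e X
}.

Lemma proj_part X (H : homogeneous_parts X) e :
  proj c d e X ∘ part_in H e = part_in H e.
Proof. by rewrite -(part_proj H) compAr (splits_id (part_splits H)) compm1. Qed.

Lemma part_degree X (H : homogeneous_parts X) e : in_degree f e (part H e).
Proof.
apply/(in_degreeE cd); rewrite -[LHS]comp1m -(splits_id (part_splits H)) compAr.
rewrite -(monodromy_nat cd) -{1}(proj_part H) (reassoc (monodromy_proj cd _ _)).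
by rewrite compZl compZr proj_part.
Qed.

(** Morphisms preserve the degree, because the monodromy is natural. *)
Lemma part_nat X Y (HX : homogeneous_parts X) (HY : homogeneous_parts Y) e
    (g : mor X Y) :
  g ∘ part_in HX e = part_in HY e ∘ (part_out HY e ∘ (g ∘ part_in HX e)).
Proof.
by rewrite compmA part_proj compmA (proj_nat cd) compAr proj_part.
Qed.

Lemma homogeneous_parts_ex X : inhabited (homogeneous_parts X).
Proof.
have [V0 [i0 [q0 [qi0 iq0]]]] :=
  split_idempotent abC (proj_idem cd char2 false X).
have [V1 [i1 [q1 [qi1 iq1]]]] :=
  split_idempotent abC (proj_idem cd char2 true X).
pose V e := if e then V1 else V0.
pose i e : mor (V e) X := if e return mor (V e) X then i1 else i0.
pose q e : mor X (V e) := if e return mor X (V e) then q1 else q0.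
have qi e : q e ∘ i e = idm (V e) by case: e.
have iq e : i e ∘ q e = proj c d e X by case: e.
constructor; apply: (@HomogeneousParts X V i q) => //; split=> //.
  by rewrite /resolves big_bool !iq [LHS]addrC proj_sum.
move=> a b ab; rewrite -[q a]comp1m -(qi a) -[i b]compm1 -(qi b) !compAr.
rewrite (compmA (i a)) iq (compmA (i b)) iq (reassoc (proj_proj _ _ _ _ _)) //.
by rewrite (negPf ab) comp0l comp0r.
Qed.

Lemma twisted_ob_ex X : inhabited (twisted_ob c d X).
Proof.
have [H] := homogeneous_parts_ex X.
have [S [j [s [js sj sj0]]]] := direct_sum_bool abC (fun e => twob f e (part H
  e)).
have TP e : twmor f e (part_out H e) ∘ twmor f e (part_in H e) = idm _.
  by rewrite -twmorM (splits_id (part_splits H)) twmor_id.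
constructor; apply: (@TwistedOb _ _ _ _ _ _ S
  (fun e => j e ∘ twmor f e (part_out H e))
  (fun e => twmor f e (part_in H e) ∘ s e)).
- rewrite /resolves -js; apply: eq_bigr => e _.
  by rewrite !compAr (reassoc (TP e)) comp1m.
- by move=> e; rewrite compAr (reassoc (sj e)) comp1m -twmorM part_proj.
- by move=> a b ab; rewrite compAr (reassoc (sj0 _ _ ab)) comp0l comp0r.
Qed.

Lemma isomorphic_zero X Y (g : mor X Y) :
  is_iso g -> is_zero_ob Y -> is_zero_ob X.
Proof.
move=> [h [hg _]] Y0; rewrite /is_zero_ob -hg -[g]comp1m.
by rewrite (Y0 : idm Y = 0) comp0l comp0r.
Qed.

(** * Equivalence and braiding of twisting functors *)

Section TwistingFunctors.
Variables (F : monFunctor C C) (twF : is_twisting_functor c F).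

(** F F is T_e T_e ≅ Id on objects of degree e. The identification th is given
only on homogeneous objects, so the isomorphism X ≅ F F X is assembled from the
homogeneous parts of X. *)
Lemma twisting_equivalence : in_degree f false f -> equivalence F.
Proof.
move=> deg_f; have [linF [th [th_iso th_nat _]]] := twF.
pose H X := inhabited_witness (homogeneous_parts_ex X).
pose u e X : mor X (twob f e (twob f e X)) :=
  if e return mor X (twob f e (twob f e X)) then cup d X else idm X.
have u_iso e X : is_iso (u e X).
  case: e => /=; last exact: is_iso_id.
  by exists (cap c X); apply/inverse_pair_sym/cap_cupK.
have u_nat e X Y (g : mor X Y) : twmor f e (twmor f e g) ∘ u e X = u e Y ∘ g.
  by case: e; rewrite /= ?cup_nat // comp1m compm1.
have deg e X : in_degree f e X -> in_degree f e (twob f e X).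
  by case: e => // hX; apply: in_degree_tens cd _ _ _ _ deg_f hX.
(* The isomorphism X ≅ T_e T_e X ≅ F F X for X of degree e. *)
pose kap e X hX := fmor F (th e X hX) ∘ (th e _ (deg e X hX) ∘ u e X).
have kap_iso e X hX : is_iso (kap e X hX).
  by do !apply: is_iso_comp => //; apply: fmor_iso.
have kap_nat e X Y hX hY (g : mor X Y) :
    fmor F (fmor F g) ∘ kap e X hX = kap e Y hY ∘ g.
  rewrite /kap !compAr (reassoc (esym (fmor_comp _ _ _))) th_nat fmor_comp.
  rewrite compAr (reassoc (th_nat _ _ _ _ (deg _ _ hY) _)) compAr.
  by rewrite u_nat.
pose eta X := \sum_e fmor F (fmor F (part_in (H X) e))
  ∘ (kap e _ (part_degree (H X) e) ∘ part_out (H X) e).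
apply: (involutive_equivalence (eta := eta)) => [X|X Y g].
  apply: (diagonal_iso (part_splits (H X)) _ _) => //.
  do 2!apply: fmor_splits => //; exact: part_splits.
apply: (resolves_epi (splits_resolves (part_splits (H X)))) => a.
rewrite !compAr (diagonal_in _ (part_splits (H X))) (part_nat _ (H Y)).
rewrite (reassoc (diagonal_in _ (part_splits (H Y)) _ _)) compAr -(kap_nat _ _
  _ (part_degree (H X) a)).
by rewrite !(reassoc (esym (fmor_comp _ _ _))) -!fmor_comp -(part_nat _ (H Y)).
Qed.

Variable t : k.
Hypotheses (br_ff : br f f = t *: idm _) (t_sq : t * t = 1).

(** The maps th are invertible, so the identity may be tested after composing
with them, where it becomes [twtau_br]. *)
Lemma homogeneous_braiding (a b : bool) X Y :
  in_degree f a X -> in_degree f b Y ->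
  tau F Y X ∘ br (F X) (F Y)
  = (if a && b then - t else 1) *: (fmor F (br X Y) ∘ tau F X Y).
Proof.
move=> hX hY; have [_ [th [th_iso th_nat th_tau]]] := twF.
apply: (iso_epi (is_iso_tens (th_iso _ _ hX) (th_iso _ _ hY))).
have hXY := in_degree_tens cd hX hY.
have hYX := in_degree_tens cd hY hX.
have hYX' : in_degree f (a (+) b) (Y ⊗ X) by rewrite addbC.
rewrite compAr br_nat (reassoc (th_tau _ _ _ _ _ _ hYX)).
rewrite compZl !compAr (th_tau _ _ _ _ _ _ hXY) (reassoc (th_nat _ _ _ _ hYX'
  _)).
rewrite !compAr.
(* The family i for [twtau_br]: th where the degree is right, 0 elsewhere.
   Being of degree e is an equation in a type with decidable equality, so it is
   decidable and its proofs are unique. *)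
have [i iE] : exists i : forall e, mor (twob f e (Y ⊗ X)) (F (Y ⊗ X)),
    forall e h, th e (Y ⊗ X) h = i e.
  exists (fun e => if br (Y ⊗ X) f =P (if e then - bri f _ else bri f _)
    is ReflectT h then th e _ h else 0) => e h.
  by case: eqP => // h'; congr (th _ _ _); apply: eq_irrelevance.
by rewrite !iE (twtau_br cd br_ff i hX hY).
Qed.

(** For t = -1 all the signs on homogeneous objects are 1, and by naturality it
is enough to compare on the homogeneous parts. *)
Lemma fermionic_braided : t = -1 -> braided_functor F.
Proof.
move=> t1 X Y; have [HX] := homogeneous_parts_ex X.
have [HY] := homogeneous_parts_ex Y.
have [linF _] := twF.
have resF Z (HZ : homogeneous_parts Z) :=
  fmor_resolves linF (splits_resolves (part_splits HZ)).
apply: (resolves_epi (resolves_tens (resF _ HX) (resF _ HY))) => [[a b]] /=.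
rewrite !compAr -tau_nat br_nat (reassoc (esym (tau_nat _ _ _))) compAr.
rewrite (homogeneous_braiding (part_degree HX a) (part_degree HY b)) t1 opprK.
by rewrite if_same scale1r (reassoc (esym (fmor_comp _ _ _))) br_nat fmor_comp
  compAr.
Qed.

(** For t = 1 the sign in degree (1, 1) is -1, so that the isomorphism
F(br) ∘ tau equals its opposite and is zero. *)
Lemma bosonic_braided_degenerate X :
  t = 1 -> braided_functor F -> in_degree f true X ->
  is_zero_ob ((f ⊗ X) ⊗ (f ⊗ X)).
Proof.
move=> t1 brF hX; have [_ [th [th_iso _ _]]] := twF.
have tau0 : fmor F (br X X) ∘ tau F X X = 0.
  have := homogeneous_braiding hX hX; rewrite -brF t1 /= scaleN1r.
  move/eqP; rewrite -subr_eq0 opprK -mulr2n -scaler_nat scaler_eq0 (negPf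
    char2).
  by move/eqP.
have FXX0 : is_zero_ob (F X ⊗ F X).
  have iso : is_iso (fmor F (br X X) ∘ tau F X X).
    apply: is_iso_comp; first exact: tau_iso.
    by apply: fmor_iso; exists (bri X X); apply: brK.
  by apply: (iso_mono iso); rewrite tau0 !comp0l.
exact: isomorphic_zero (is_iso_tens (th_iso _ _ hX) (th_iso _ _ hX)) FXX0.
Qed.

End TwistingFunctors.

End Homogeneous.

(** * Traces and duals *)

Section Duals.
Variables (k : fieldType) (C : monCat k).

(** The transpose of g with respect to the two dualities. Applied to the
identity it compares two duals of one object. *)
Lemma mate (X X' Y Y' : C) eX dX eY dY (g : mor X Y) :
  @zigzag k C X X' eX dX -> @zigzag k C Y Y' eY dY ->
  exists u : mor Y' X',
    (g ⊠ idm X') ∘ dX = (idm Y ⊠ u) ∘ dY /\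
    eX ∘ (u ⊠ idm X) = eY ∘ (idm Y' ⊠ g).
Proof.
move=> zX zY.
exists (cap eY X' ∘ ((idm Y' ⊠ ((g ⊠ idm X') ∘ dX)) ∘ runi Y')); split.
  rewrite !(tensmMr Y (cap _ _)) (tensmMr Y (_ ⊠ _)) !compAr -cup_unit cup_nat.
  by rewrite compmA (zigzag_cap _ zY) comp1m.
rewrite !tensmMl -cap_tens !compAr (reassoc (esym (cap_nat _ _))) !compAr.
rewrite (reassoc (asc_nat _ _ _)) !compAr.
have tri : asc Y' 𝟙 X ∘ (runi Y' ⊠ idm X) = idm Y' ⊠ luni X.
  have mono : is_mono (idm Y' ⊠ lun X).
    exact: inv_mono (inverse_pair_tens (inverse_pair_id _) (lunK _)).
  by apply: mono; rewrite compmA triangle -tensmMl -tensmMr runKr lunKr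
    !tensm_id.
rewrite tri cap_unit !compAr -!tensmMr; congr (_ ∘ (_ ⊠ _)).
have -> : asc Y X' X ∘ ((((g ⊠ idm X') ∘ dX) ⊠ idm X) ∘ luni X)
    = (g ⊠ idm (X' ⊗ X)) ∘ cup dX X.
  by rewrite tensmMl compAr (reassoc (asc_nat _ _ _)) tensm_id cup.unlock
    !compAr.
rewrite (reassoc (esym (tensm_exchange _ _))) !compAr zX runi_nat.
by rewrite (reassoc (runKr _)) comp1m.
Qed.

Section TensorDual.
Variables (A A' B B' : C) (eA : mor (A' ⊗ A) 𝟙) (dA : mor 𝟙 (A ⊗ A')).
Variables (eB : mor (B' ⊗ B) 𝟙) (dB : mor 𝟙 (B ⊗ B')).

(** The dual of A ⊗ B is B' ⊗ A', with nested caps and cups. *)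
Definition tens_ev : mor ((B' ⊗ A') ⊗ (A ⊗ B)) 𝟙 :=
  eB ∘ ((idm B' ⊠ cap eA B) ∘ asc B' A' (A ⊗ B)).

Definition tens_coev : mor 𝟙 ((A ⊗ B) ⊗ (B' ⊗ A')) :=
  asci A B (B' ⊗ A') ∘ ((idm A ⊠ cup dB A') ∘ dA).

Lemma cup_tens_coev W :
  (idm A ⊠ (idm B ⊠ asc B' A' W))
    ∘ (asc A B ((B' ⊗ A') ⊗ W) ∘ cup tens_coev W)
  = (idm A ⊠ cup dB (A' ⊗ W)) ∘ cup dA W.
Proof.
rewrite (cupE tens_coev) /tens_coev !tensmMl !compAr.
rewrite (reassoc (esym (pentagonr _ _ _ _))) !compAr.
rewrite (reassoc (esym (tensmMl W (asc _ _ _) _))) ascKr tensm_id comp1m.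
rewrite (reassoc (asc_nat _ _ _)) !compAr.
rewrite 2!(reassoc (esym (tensmMr A _ _))) !compAr cup_tens.
by rewrite (cupE dA).
Qed.

Lemma zigzag_tens :
  zigzag eA dA -> zigzag eB dB -> zigzag tens_ev tens_coev.
Proof.
move=> zA zB; apply: (@asc_mono _ _ A B 𝟙).
rewrite -runi_tens -(tensm_id A B) (reassoc (asc_nat _ _ _)) !compAr.
rewrite /tens_ev 4!tensmMr !compAr cup_tens_coev.
rewrite !(reassoc (esym (tensmMr A _ _))) !compAr cup_nat.
rewrite (reassoc zB) tensmMr compAr zigzag_cap //.
by rewrite compm1.
Qed.

End TensorDual.
End Duals.

Section Ribbon.
Variables (k : fieldType) (C : ribbonCat k).
Implicit Types X Y : C.

(** By duality X is a retract of X ⊗ X' ⊗ X, which is X ⊗ X ⊗ X' up to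
braiding. *)
Lemma tens_square_zero X : is_zero_ob (X ⊗ X) -> is_zero_ob X.
Proof.
move=> XX0; have zX := dual_zigzag (dualP X).
have Z : is_zero_ob (X ⊗ (dual_ob X ⊗ X)).
  have iso : is_iso (asci X X (dual_ob X) ∘ (idm X ⊠ br (dual_ob X) X)).
    apply: is_iso_comp.
      by apply: is_iso_tens; [exact: is_iso_id | eexists; exact: brK].
    by eexists; apply: inverse_pair_sym; exact: ascK.
  apply: isomorphic_zero iso _.
  by rewrite /is_zero_ob -tensm_id (XX0 : idm _ = 0) tensm0l.
rewrite /is_zero_ob -(runKr X) -zX -[cup _ _]comp1m (Z : idm _ = 0).
by rewrite comp0l !comp0r.
Qed.

(** The quantum trace computed with an arbitrary dual of X. By [trace_cyclic] it
does not depend on that dual. *)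
Definition trace_of X X' (e : mor (X' ⊗ X) 𝟙) (d : mor 𝟙 (X ⊗ X'))
    (g : mor X X) : mor (𝟙 : C) 𝟙 :=
  e ∘ (br X X' ∘ (((twist X ∘ g) ⊠ idm X') ∘ d)).

Lemma qtraceE X (g : mor X X) : qtrace g = trace_of (ev X) (coev X) g.
Proof. by rewrite /qtrace /trace_of !compAr. Qed.

Lemma trace_cyclic X X' Y Y' eX dX eY dY (g : mor X Y) (h : mor Y X) :
  @zigzag k C X X' eX dX -> @zigzag k C Y Y' eY dY ->
  trace_of eX dX (h ∘ g) = trace_of eY dY (g ∘ h).
Proof.
move=> zX zY; have [u [du eu]] := mate g zX zY.
rewrite /trace_of (compmA (twist X)) tensmMl compAr du.
rewrite (reassoc (tensm_exchange _ _)) !compAr (reassoc (br_nat _ _)) !compAr.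
rewrite (reassoc eu) !compAr (reassoc (esym (br_nat _ _))) !compAr.
by rewrite (reassoc (esym (tensmMl _ _ _))) (compmA g) -twist_nat compAr.
Qed.

Section TransparentTrace.
Variables (f : C) (c : mor (f ⊗ f) 𝟙) (d : mor 𝟙 (f ⊗ f)) (dd : mor 𝟙 (f ⊗ f)).
Hypothesis cd : inverse_pair c d.
Variables (t s : k).
Hypotheses (br_ff : br f f = t *: idm _) (twist_f : twist f = s *: idm f).
Variables (X X' : C) (e : mor (X' ⊗ X) 𝟙) (dX : mor 𝟙 (X ⊗ X')).
Hypotheses (degX : in_degree f false X) (degX' : in_degree f false X').

(** The strand of f has trivial double braiding with X', so it can be pulled off
the loop of X. What remains is the trace of X times a closed loop of f, whose
value does not depend on X. *)
Lemma trace_tens_transparent a :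
  trace_of e dX (idm X) = a *: idm 𝟙 ->
  trace_of (tens_ev c e) (tens_coev dd dX) (idm (f ⊗ X))
  = a *: (s * t *: (cap c 𝟙 ∘ ((idm f ⊠ (br 𝟙 f ∘ luni f)) ∘ dd))).
Proof.
rewrite /trace_of !compm1 => tr.
have tw : twist (f ⊗ X) = s *: (idm f ⊠ twist X).
  have := twist_tens f X; rewrite twist_f => ->.
  have -> : br X f ∘ br f X = idm _.
    by rewrite -(monodromyE cd) (proj1 (in_degreeE cd false X) degX) expr0
      scale1r
      tensm_id.
  by rewrite comp1m tensmZl.
rewrite tw tensmZl compZl !compZr /tens_coev.
rewrite (reassoc (esym (asci_nat _ _ _))) !compAr.
rewrite (reassoc (esym (tensmMr f _ _))).
rewrite br_tensl !compAr (reassoc (ascKr _ _ _)) comp1m.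
rewrite (reassoc (esym (tensmMr f _ _))).
have -> : br X (X' ⊗ f) ∘ ((twist X ⊠ idm (X' ⊗ f)) ∘ cup dX f)
    = asci X' f X ∘ ((idm X' ⊠ br X f) ∘ (asc X' X f
      ∘ (((br X X' ∘ ((twist X ⊠ idm X') ∘ dX)) ⊠ idm f) ∘ luni f))).
  rewrite br_tensr cupE -tensm_id (reassoc (esym (asc_nat _ _ _))) !compAr.
  by rewrite (reassoc (swap_asc _ _ _)) !tensmMl !compAr.
rewrite (reassoc (swap_tensr _ _ _ _)) !compAr (swap_self br_ff).
rewrite (reassoc (esym (tensmMr f _ _))) (reassoc (ascKr _ _ _)) comp1m.
rewrite tensmZr tensm_id compZl comp1m !compZr scalerA.
rewrite -(cap_swapr c) !compAr (reassoc (swap_swap_degree cd _ degX')).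
rewrite expr0 scale1r comp1m (reassoc (esym (cap_nat _ _))) !compAr.
rewrite 2!(reassoc (esym (tensmMr f _ _))) !compAr.
rewrite (reassoc3 (esym (br_tensl X' X f))) (reassoc (esym (br_nat _ _)))
  !compAr.
rewrite (reassoc (esym (tensmMl f _ _))) tr tensmZl tensm_id compZl comp1m.
by rewrite compZr tensmZr compZl compZr !scalerA mulrC.
Qed.

End TransparentTrace.

End Ribbon.

(** * Transparent objects of modular categories *)

Section Modular.
Variables (k : fieldType) (C : modularCat k).
Implicit Types X Y V : C.

Lemma unit_nonzero : ~ is_zero_ob (𝟙 : C).
Proof.
move=> id0; have : (fullv <= (0 : {vspace mor (𝟙 : C) 𝟙}))%VS.
  by apply/subvP => h _; rewrite -[h]comp1m id0 comp0l mem0v.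
by move/dimvS; rewrite (mod_unit C) dimv0.
Qed.

Lemma unit_scalar (g : mor (𝟙 : C) 𝟙) : exists a, g = a *: idm 𝟙.
Proof.
have dim1 := mod_unit C.
have id0 : idm (𝟙 : C) != 0.
  by apply/eqP; apply: unit_nonzero.
have line : (<[idm 𝟙]>%VS : {vspace mor (𝟙 : C) 𝟙}) = fullv.
  by apply/eqP; rewrite eqEdim subvf dim1 dim_vline id0.
have : g \in <[idm 𝟙]>%VS by rewrite line memvf.
by move/vlineP.
Qed.

(** An object with only scalar endomorphisms cannot have two summands: one of
the projections i ∘ p is a non-zero scalar and idempotent, so the identity. *)
Lemma scalar_simple X :
  (forall g : mor X X, exists a, g = a *: idm X) -> ~ is_zero_ob X ->
  exists2 V, simple_ob V & isomorphic X V.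
Proof.
move=> scal nz; have [_ /(_ X) [n [V [sV [i [p [pi pi0 ip]]]]]]] :=
  mod_semisimple C.
have [j ij|all0] := pickP (fun j => i j ∘ p j != 0); last first.
  case: nz; rewrite /is_zero_ob -ip big1 // => j _.
  by apply/eqP; rewrite -[_ == _]negbK all0.
exists (V j); first exact: sV.
have [a ipa] := scal (i j ∘ p j).
have a1 : a *: (i j ∘ p j) = i j ∘ p j.
  by rewrite -[in RHS](comp1m (p j)) -(pi j) !compmA {2}ipa !compAr compZl
    comp1m.
exists (p j), (i j); split; last exact: pi.
rewrite ipa; suff -> : a = 1 by rewrite scale1r.
apply/eqP; rewrite -subr_eq0; move/eqP: a1; rewrite -subr_eq0.
rewrite -[X in _ - X]scale1r -scalerBl scaler_eq0 => /orP[//|].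
by rewrite (negPf ij).
Qed.

Lemma isomorphic_sym X Y : isomorphic X Y -> isomorphic Y X.
Proof. by move=> [g [h gh]]; exists h, g; apply: inverse_pair_sym. Qed.

Lemma isomorphic_trans X Y Z :
  isomorphic X Y -> isomorphic Y Z -> isomorphic X Z.
Proof.
by move=> [g ig] [h ih]; exists (h ∘ g); apply: is_iso_comp.
Qed.

Lemma double_braiding_iso X Y V :
  isomorphic X Y -> br V Y ∘ br Y V = idm _ -> br V X ∘ br X V = idm _.
Proof.
move=> [g [h [hg gh]]] bb.
rewrite -[LHS]comp1m -tensm_id -hg tensmMl compAr.
rewrite (reassoc (esym (br_nat _ _))) !compAr -br_nat.
by rewrite (reassoc bb) comp1m -tensmMl hg tensm_id.
Qed.

Lemma qtrace_iso X Y : isomorphic X Y -> qtrace (idm X) = qtrace (idm Y).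
Proof.
move=> [g [h [hg gh]]]; rewrite !qtraceE -hg -gh.
exact: trace_cyclic (dual_zigzag (dualP X)) (dual_zigzag (dualP Y)).
Qed.

Lemma double_braiding_unit V : br V 𝟙 ∘ br 𝟙 V = idm _.
Proof. by apply: lun_mono; rewrite (reassoc (lun_br _)) run_br compm1. Qed.

(** Non-degeneracy. Both f and 𝟙 are isomorphic to simple representatives,
because their endomorphisms are scalars. If f has trivial double braiding with
everything, then the two corresponding rows of S are proportional by
multiplicativity of traces, so the two representatives coincide. *)
Lemma transparent_trivial (f : C) (c : mor (f ⊗ f) 𝟙) d dd (t : k) :
  inverse_pair c d -> zigzag c dd -> br f f = t *: idm _ ->
  (forall X, in_degree f false X) -> isomorphic f 𝟙.
Proof.
move=> cd zc br_ff deg.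
have scal_f (g : mor f f) : exists a, g = a *: idm f.
  have [a ga] := unit_scalar (c ∘ ((idm f ⊠ g) ∘ d)).
  exists a; apply: (whisker_inj cd); apply: (inv_mono cd).
  apply: (inv_epi (inverse_pair_sym cd)); rewrite !compAr ga tensmZr tensm_id.
  by rewrite compZl comp1m compZr; case: cd => _ ->.
have nz_f : ~ is_zero_ob f.
  move=> f0; apply: unit_nonzero; rewrite /is_zero_ob; case: cd => _ <-.
  by rewrite -[d]comp1m -tensm_id (f0 : idm f = 0) tensm0l comp0l comp0r.
have [n [V [S [[sV uV rV] SV uS]]]] := mod_S C.
have rep X : (forall g : mor X X, exists a, g = a *: idm X) -> ~ is_zero_ob X ->
    exists j, isomorphic X (V j).
  move=> sX nX; have [W sW XW] := scalar_simple sX nX.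
  by have [j WV] := rV W sW; exists j; apply: isomorphic_trans XW WV.
have [i1 fi1] := rep f scal_f nz_f.
have [i0 ui0] := rep 𝟙 unit_scalar unit_nonzero.
have [i01|i01] := eqVneq i1 i0.
  by rewrite i01 in fi1; apply: isomorphic_trans fi1 (isomorphic_sym ui0).
have [s twist_f] := scal_f (twist f).
have [z zE] := unit_scalar (s * t *: (cap c 𝟙 ∘ ((idm f ⊠ (br 𝟙 f ∘ luni f)) ∘
  dd))).
have iso_tens X Y Z : isomorphic X Y -> isomorphic (X ⊗ Z) (Y ⊗ Z).
  by move=> [g ig]; exists (g ⊠ idm Z); apply: is_iso_tens ig (is_iso_id _).
have scale_inj (a b : k) : a *: idm (𝟙 : C) = b *: idm 𝟙 -> a = b.
  move/eqP; rewrite -subr_eq0 -scalerBl scaler_eq0 subr_eq0.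
  by case/orP=> [/eqP //|/eqP/unit_nonzero].
have row_prop j : S i1 j = z * S i0 j.
  apply: scale_inj; rewrite SV.
  have -> : br (V j) (V i1) ∘ br (V i1) (V j) = idm _.
    apply: (double_braiding_iso (isomorphic_sym fi1)).
    rewrite -(monodromyE cd) (proj1 (in_degreeE cd false _) (deg (V j))).
    by rewrite expr0 scale1r tensm_id.
  rewrite (qtrace_iso (iso_tens _ _ _ (isomorphic_sym fi1))).
  have S0 : S i0 j *: idm 𝟙 = qtrace (idm (V j)).
    rewrite SV (double_braiding_iso (isomorphic_sym ui0) (double_braiding_unit
      _)).
    apply: qtrace_iso; apply: isomorphic_trans (iso_tens _ _ _ (isomorphic_sym
      ui0)) _.
    by exists (lun (V j)), (luni (V j)); apply: lunK.
  have zV := dual_zigzag (dualP (V j)).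
  have -> : qtrace (idm (f ⊗ V j))
      = trace_of (tens_ev c (ev (V j))) (tens_coev dd (coev (V j))) (idm _).
    rewrite qtraceE -[X in trace_of _ _ X]comp1m -[in RHS](comp1m (idm (f ⊗ V
      j))).
    exact: trace_cyclic (dual_zigzag (dualP _)) (zigzag_tens zc zV).
  rewrite (trace_tens_transparent dd cd br_ff twist_f (deg _) (deg _) (a := S
    i0 j)).
    by rewrite zE scalerA mulrC.
  by rewrite -qtraceE -S0.
(* A row vector killed by S, non-zero at i1. *)
pose v := delta_mx 0 i1 - z *: delta_mx 0 i0 : 'rV[k]_n.
have vS : v *m S = 0.
  apply/rowP=> j; rewrite mulmxBl -scalemxAl -!rowE !mxE row_prop.
  by rewrite subrr.
have : v 0 i1 = 0 by rewrite -(mulmxK uS v) vS mul0mx mxE.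
rewrite !mxE !eqxx (negPf i01) mulr0 subr0 => /eqP.
by rewrite oner_eq0.
Qed.

End Modular.

(** * The twisting theorem *)

(** On f ⊗ f ≅ 𝟙 the evaluation is a scalar multiple of any isomorphism, and
the scalar is not zero since otherwise f would be zero. *)
Lemma eval_inverse (k : fieldType) (C : modularCat k) (f : C)
    (c : mor (f ⊗ f) 𝟙) (dd : mor 𝟙 (f ⊗ f)) :
  dual_pair c dd -> isomorphic (f ⊗ f) 𝟙 -> exists d, inverse_pair c d.
Proof.
move=> [zz _] [g [h [hg gh]]]; have [a ca] := unit_scalar (c ∘ h).
have cg : c = a *: g by rewrite -[c]compm1 -hg compmA ca compZl comp1m.
have a0 : a != 0.
  apply/eqP => a0; have f0 : is_zero_ob f.
    by rewrite /is_zero_ob -zz cg a0 scale0r tensm0r comp0r !comp0l.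
  apply: (@unit_nonzero _ C); rewrite /is_zero_ob -gh -[h]comp1m.
  by rewrite -tensm_id (f0 : idm f = 0) tensm0l comp0l comp0r.
exists (a^-1 *: h); rewrite cg; split; rewrite compZl compZr scalerA.
  by rewrite mulVf // hg scale1r.
by rewrite mulfV // gh scale1r.
Qed.

Theorem theorem9p3 (k : closedFieldType) (hk : [pchar k] =i pred0)
  (C : modularCat k) (f : C) (hf : boson f \/ fermion f)
  (evf : mor (f ⊗ f) 𝟙) (coevf : mor 𝟙 (f ⊗ f)) (hev : dual_pair evf coevf) :
  (exists F : monFunctor C C, is_twisting_functor evf F) /\
  (forall F : monFunctor C C, is_twisting_functor evf F ->
    equivalence F /\ (braided_functor F <-> fermion f)).
Proof.
have char2 : 2%:R != 0 :> k.
  by apply/negP => two0; have := hk 2; rewrite !inE /= two0.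
have inv_f : involutive_ob f by case: hf => -[].
have [t [br_ff t_sq tE]] : exists t : k,
    [/\ br f f = t *: idm (f ⊗ f), t * t = 1 & boson f /\ t = 1 \/ fermion f
      /\ t = -1].
  have [[hb bb]|[hb bb]] := hf; [exists 1 | exists (-1)]; split.
  - by rewrite bb scale1r.
  - by rewrite mulr1.
  - by left.
  - by rewrite bb scaleN1r.
  - by rewrite mulrNN mulr1.
  - by right.
have [nontrivial_f _ ff1] := inv_f.
have [d cd] := eval_inverse hev ff1.
have [abC _] := mod_semisimple C.
split.
  exists (twisting cd char2 br_ff t_sq
    (fun X => inhabited_witness (twisted_ob_ex cd char2 abC X))).
  exact: twisting_is_twisting.
move=> F twF; split.
  exact: (twisting_equivalence cd char2 abC twF (in_degree_self cd br_ff t_sq)).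
split=> [brF|[_ br_f]].
- case: tE => [[_ t1]|[] //]; case: nontrivial_f.
  apply: (transparent_trivial cd (dual_zigzag hev) br_ff) => X.
  have [H] := homogeneous_parts_ex cd char2 abC X.
  have part0 : is_zero_ob (part H true).
    have := bosonic_braided_degenerate cd char2 twF br_ff t1 brF (part_degree
      cd H true).
    move/tens_square_zero => fpart0; apply: (whisker_inj cd).
    by rewrite tensm_id tensm0r.
  have proj0 : proj evf d true X = 0.
    by rewrite -(part_proj H) -[part_in H true]compm1 (part0 : idm _ = 0)
      comp0r comp0l.
  apply/(in_degreeE cd); rewrite expr0 scale1r.
  have := monodromy_proj cd false X.
  have <- : idm X = proj evf d false X by rewrite -(proj_sum evf d char2)
    proj0 addr0.
  by rewrite compm1 expr0 scale1r.
- apply: (fermionic_braided cd char2 abC twF (t := -1)) => //.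
  by rewrite br_f scaleN1r.
Qed.
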